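(* (GBC) The principle $\mathrm{ETR}_{\mathrm{Ord}}$ implies that every class forcing notion $\mathbb P$ admits a uniform forcing relation for assertions in the forcing language $\mathcal L_{\mathrm{Ord},\mathrm{Ord}}(\in,V^{\mathbb P},\dot\Gamma_0,\ldots,\dot\Gamma_m)$, for any fixed class names $\dot\Gamma_i$.
   Context: $\mathrm{ETR}_{\mathrm{Ord}}$: for every first-order formula $\varphi(x,X,A)$ and class $A$ there is a class $S\subseteq\mathrm{Ord}\times V$ with $S_\alpha=\{x:\varphi(x,S\restriction\alpha,A)\}$ for all $\alpha$, where $S_\alpha=\{x:\langle\alpha,x\rangle\in S\}$ and $S\restriction\alpha=S\cap(\alpha\times V)$. A class forcing notion is a separative class pre-order $\mathbb P$ with top $\mathbb 1$; class names are classes of pairs $\langle\rho,p\rangle$, $\rho$ a $\mathbb P$-name. $\mathcal L_{\mathrm{Ord},\mathrm{Ord}}(\in,V^{\mathbb P},\dot\Gamma_0,\ldots,\dot\Gamma_m)$: formulas with $\in$, $\mathbb P$-names as constants, predicates for the $\dot\Gamma_i$, built from atomic formulas by negation, set-sized conjunctions, and set-sized blocks of universal quantifiers. A uniform forcing relation for it is a relation $\Vdash$ on all its formulas such that: $p\Vdash\sigma\in\tau$ iff densely many $q\le p$ have $\langle\rho,r\rangle\in\tau$ with $q\le r$, $q\Vdash\sigma=\rho$; $p\Vdash\sigma=\tau$ iff $p\Vdash\sigma\subseteq\tau$ and $p\Vdash\tau\subseteq\sigma$, where $p\Vdash\sigma\subseteq\tau$ iff whenever $\langle\rho,r\rangle\in\sigma$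 and $q'\le p,r$ there is $q\le q'$ with $q\Vdash\rho\in\tau$; $p\Vdash\sigma\in\dot\Gamma_i$ iff densely many $q\le p$ have $\langle\tau,r\rangle\in\dot\Gamma_i$ with $q\le r$, $q\Vdash\sigma=\tau$; $p\Vdash\bigwedge_j\varphi_j$ iff $p\Vdash\varphi_j$ for all $j$; $p\Vdash\neg\varphi$ iff no $q\le p$ forces $\varphi$; $p\Vdash\forall\vec x\,\varphi(\vec x)$ (with $\vec x=\langle x_i:i\in I\rangle$) iff $p\Vdash\varphi(\vec\tau)$ for all sequences of names $\langle\tau_i:i\in I\rangle$. *)

(* Defs.v *)
From mathcomp Require Import all_boot.

Set Implicit Arguments.
Unset Strict Implicit.
Unset Printing Implicit Defensive.

(** * Two-sorted structures and the axioms of GBC *)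

(* Equality of sets and of classes is Leibniz equality. *)
Record gb_structure := GBStructure {
  gset :> Type;
  gclass : Type;
  smem : gset -> gset -> Prop;
  cmem : gset -> gclass -> Prop
}.

Declare Scope gb_scope.
Notation "x ∈ y" := (smem x y) (at level 70, no associativity) : gb_scope.
Notation "x ∈c X" := (cmem x X) (at level 70, no associativity) : gb_scope.
Local Open Scope gb_scope.

(* First-order formulas: quantifiers range over sets only. Set variables are
   de Bruijn indices; class variables are always free. *)
Inductive fo_formula : Type :=
  | fo_eq of nat & nat
  | fo_mem of nat & nat
  | fo_cmem of nat & nat
  | fo_not of fo_formula
  | fo_and of fo_formula & fo_formula
  | fo_all of fo_formula.

Definition env_cons (T : Type) (x : T) (e : nat -> T) : nat -> T :=
  fun n => if n is k.+1 then e k else x.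

Fixpoint fo_sat (M : gb_structure) (e : nat -> M) (E : nat -> gclass M)
    (phi : fo_formula) : Prop :=
  match phi with
  | fo_eq i j => e i = e j
  | fo_mem i j => e i ∈ e j
  | fo_cmem i k => e i ∈c E k
  | fo_not psi => ~ fo_sat e E psi
  | fo_and psi chi => fo_sat e E psi /\ fo_sat e E chi
  | fo_all psi => forall x : M, fo_sat (env_cons x e) E psi
  end.

Definition empty (M : gb_structure) (x : M) : Prop := forall z : M, ~ z ∈ x.

Definition is_pair (M : gb_structure) (a b c : M) : Prop :=
  forall z : M, z ∈ c <-> z = a \/ z = b.

Definition is_opair (M : gb_structure) (a b c : M) : Prop :=
  exists u v : M, [/\ is_pair a a u, is_pair a b v & is_pair u v c].

Definition is_union2 (M : gb_structure) (a b c : M) : Prop :=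
  forall z : M, z ∈ c <-> z ∈ a \/ z ∈ b.

Definition is_succ (M : gb_structure) (a c : M) : Prop :=
  forall z : M, z ∈ c <-> z ∈ a \/ z = a.

Definition opair_in (M : gb_structure) (a b y : M) : Prop :=
  exists2 z : M, is_opair a b z & z ∈ y.

Definition opair_inc (M : gb_structure) (a b : M) (X : gclass M) : Prop :=
  exists2 z : M, is_opair a b z & z ∈c X.

Definition functional_class (M : gb_structure) (F : gclass M) : Prop :=
  forall x y y' : M, opair_inc x y F -> opair_inc x y' F -> y = y'.

Record GBC (M : gb_structure) : Prop := {
  gbc_set_ext : forall x y : M, (forall z : M, z ∈ x <-> z ∈ y) -> x = y;
  gbc_class_ext : forall X Y : gclass M,
    (forall z : M, z ∈c X <-> z ∈c Y) -> X = Y;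
  gbc_pairing : forall a b : M, exists c : M, is_pair a b c;
  gbc_union : forall a : M, exists u : M,
    forall z : M, z ∈ u <-> exists2 y : M, y ∈ a & z ∈ y;
  gbc_power : forall a : M, exists p : M,
    forall y : M, y ∈ p <-> (forall z : M, z ∈ y -> z ∈ a);
  gbc_infinity : exists w : M,
    (exists2 x : M, empty x & x ∈ w) /\
    (forall x : M, x ∈ w -> exists2 y : M, is_succ x y & y ∈ w);
  gbc_foundation : forall a : M, ~ empty a ->
    exists2 x : M, x ∈ a & forall z : M, z ∈ x -> ~ z ∈ a;
  gbc_comprehension : forall (phi : fo_formula) (e : nat -> M)
    (E : nat -> gclass M),
    exists X : gclass M, forall x : M, x ∈c X <-> fo_sat (env_cons x e) E phi;
  gbc_replacement : forall F : gclass M, functional_class F ->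
    forall a : M, exists b : M,
    forall y : M, y ∈ b <-> exists2 x : M, x ∈ a & opair_inc x y F;
  gbc_global_choice : exists2 F : gclass M, functional_class F &
    forall x : M, ~ empty x -> exists2 y : M, y ∈ x & opair_inc x y F
}.

(** * Elementary transfinite recursion of length Ord *)

Definition transitive_set (M : gb_structure) (x : M) : Prop :=
  forall y z : M, y ∈ x -> z ∈ y -> z ∈ x.

(* Adequate in the presence of foundation. *)
Definition is_ordinal (M : gb_structure) (x : M) : Prop :=
  transitive_set x /\ forall y : M, y ∈ x -> transitive_set y.

(* R is the intersection of S with alpha x V. *)
Definition is_restriction (M : gb_structure) (S : gclass M) (alpha : M)
    (R : gclass M) : Prop :=
  forall z : M, z ∈c R <->
    z ∈c S /\ exists beta x : M, beta ∈ alpha /\ is_opair beta x z.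

(* In phi every set variable that is free denotes x, class variable 0 denotes
   the restriction of S, and all other class variables denote A; so phi is in
   effect an arbitrary formula phi(x, X, A) without other parameters. *)
Definition ETR_Ord (M : gb_structure) : Prop :=
  forall (phi : fo_formula) (A : gclass M), exists S : gclass M,
    (forall z : M, z ∈c S -> exists alpha x : M,
       is_ordinal alpha /\ is_opair alpha x z) /\
    (forall alpha : M, is_ordinal alpha ->
     forall R : gclass M, is_restriction S alpha R ->
     forall x : M, opair_inc alpha x S <->
       fo_sat (fun=> x) (fun k => if k is 0 then R else A) phi).

(** * Class forcing notions and names *)

Record forcing_data (M : gb_structure) := ForcingData {
  conditions : gclass M;
  order : gclass M;
  top : M
}.

Definition fcond (M : gb_structure) (P : forcing_data M) (p : M) : Prop :=
  p ∈c conditions P.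

Definition fle (M : gb_structure) (P : forcing_data M) (q p : M) : Prop :=
  opair_inc q p (order P).

Definition compatible (M : gb_structure) (P : forcing_data M) (p q : M) : Prop :=
  exists r : M, fle P r p /\ fle P r q.

Record class_forcing (M : gb_structure) (P : forcing_data M) : Prop := {
  cf_order : forall z : M, z ∈c order P ->
    exists q p : M, [/\ fcond P q, fcond P p & is_opair q p z];
  cf_refl : forall p : M, fcond P p -> fle P p p;
  cf_trans : forall p q r : M, fle P r q -> fle P q p -> fle P r p;
  cf_top : fcond P (top P);
  cf_top_max : forall p : M, fcond P p -> fle P p (top P);
  cf_separative : forall p q : M, fcond P p -> fcond P q -> ~ fle P p q ->
    exists2 r : M, fle P r p & ~ compatible P r q
}.

(* "x is a set of pairs <rho, p> with rho a name and p a condition".  The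
   recursion has to be carried out inside M, whose membership relation may be
   externally ill-founded, so it is expressed by a witnessing set t closed under
   the recursive clause rather than by an inductive predicate. *)
Definition is_name (M : gb_structure) (P : forcing_data M) (x : M) : Prop :=
  exists2 t : M, x ∈ t &
    forall y z : M, y ∈ t -> z ∈ y ->
      exists rho p : M, [/\ rho ∈ t, fcond P p & is_opair rho p z].

Definition is_class_name (M : gb_structure) (P : forcing_data M)
    (G : gclass M) : Prop :=
  forall z : M, z ∈c G ->
    exists rho p : M, [/\ is_name P rho, fcond P p & is_opair rho p z].

(** * The infinitary forcing language, coded by sets of M

   Variables x_i are indexed by arbitrary sets i.
     variable x_i      <0, i>            constant sigma       <1, sigma>
     s in t            <0, <s, t>>       s = t                <1, <s, t>>
     s in Gamma_i      <2, <i, s>>       not phi              <3, phi>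
     conjunction of the set Phi of formulas                   <4, Phi>
     universal quantification over all x_i with i in I        <5, <I, phi>>  *)

Fixpoint is_numeral (M : gb_structure) (n : nat) (x : M) : Prop :=
  if n is k.+1 then exists2 y : M, is_numeral k y & is_succ y x
  else empty x.

Definition tagged (M : gb_structure) (n : nat) (a c : M) : Prop :=
  exists2 k : M, is_numeral n k & is_opair k a c.

Definition tagged2 (M : gb_structure) (n : nat) (a b c : M) : Prop :=
  exists2 u : M, is_opair a b u & tagged n u c.

Definition t_var (M : gb_structure) (i s : M) : Prop := tagged 0 i s.
Definition t_name (M : gb_structure) (sigma s : M) : Prop := tagged 1 sigma s.

Definition f_mem (M : gb_structure) (s t phi : M) : Prop := tagged2 0 s t phi.
Definition f_eq (M : gb_structure) (s t phi : M) : Prop := tagged2 1 s t phi.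
Definition f_gamma (M : gb_structure) (m : nat) (i : 'I_m.+1) (s phi : M) : Prop :=
  exists2 k : M, is_numeral i k & tagged2 2 k s phi.
Definition f_not (M : gb_structure) (psi phi : M) : Prop := tagged 3 psi phi.
Definition f_and (M : gb_structure) (Phi phi : M) : Prop := tagged 4 Phi phi.
Definition f_all (M : gb_structure) (I psi phi : M) : Prop := tagged2 5 I psi phi.

(* s is a term whose variable, if any, has its index in U. *)
Definition is_term (M : gb_structure) (P : forcing_data M) (U s : M) : Prop :=
  (exists2 i : M, i ∈ U & t_var i s) \/
  (exists2 sigma : M, is_name P sigma & t_name sigma s).

(* One step of the recursive definition of "phi is a formula whose free
   variables have their indices in U". *)
Definition formula_step (M : gb_structure) (P : forcing_data M) (m : nat)
    (fml : M -> M -> Prop) (U phi : M) : Prop :=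
  (exists s t : M, [/\ is_term P U s, is_term P U t & f_mem s t phi]) \/
  (exists s t : M, [/\ is_term P U s, is_term P U t & f_eq s t phi]) \/
  (exists (i : 'I_m.+1) (s : M), is_term P U s /\ f_gamma i s phi) \/
  (exists psi : M, fml U psi /\ f_not psi phi) \/
  (exists Phi : M, (forall psi : M, psi ∈ Phi -> fml U psi) /\ f_and Phi phi) \/
  (exists I psi W : M, [/\ is_union2 U I W, fml W psi & f_all I psi phi]).

(* The recursion is internalized as in is_name; t is a set of pairs <U, phi>. *)
Definition is_formula (M : gb_structure) (P : forcing_data M) (m : nat)
    (U phi : M) : Prop :=
  exists2 t : M, opair_in U phi t &
    forall V psi : M, opair_in V psi t ->
      formula_step P m (fun W chi => opair_in W chi t) V psi.

(* The assertions of the forcing language: formulas without free variables. *)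
Definition is_sentence (M : gb_structure) (P : forcing_data M) (m : nat)
    (phi : M) : Prop :=
  exists2 U : M, empty U & is_formula P m U phi.

(* f is a sequence of names indexed by the set I. *)
Definition name_sequence (M : gb_structure) (P : forcing_data M)
    (I f : M) : Prop :=
  (forall z : M, z ∈ f -> exists i tau : M,
     [/\ i ∈ I, is_name P tau & is_opair i tau z]) /\
  (forall i : M, i ∈ I -> exists! tau : M, opair_in i tau f).

Definition term_subst (M : gb_structure) (f s s' : M) : Prop :=
  (exists i tau : M, [/\ t_var i s, opair_in i tau f & t_name tau s']) \/
  (exists2 i : M, t_var i s & (forall tau : M, ~ opair_in i tau f) /\ s' = s) \/
  (exists2 sigma : M, t_name sigma s & s' = s).

(* g is f with the variables in I removed from its domain. *)
Definition remove_vars (M : gb_structure) (I f g : M) : Prop :=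
  forall z : M, z ∈ g <->
    z ∈ f /\ ~ exists i tau : M, i ∈ I /\ is_opair i tau z.

(* One step of the recursive definition of "psi results from phi by replacing
   every free occurrence of x_i, i in dom f, by the constant f(i)". *)
Definition subst_step (M : gb_structure) (m : nat) (sub : M -> M -> M -> Prop)
    (f phi psi : M) : Prop :=
  (exists s t s' t' : M, [/\ term_subst f s s', term_subst f t t',
     f_mem s t phi & f_mem s' t' psi]) \/
  (exists s t s' t' : M, [/\ term_subst f s s', term_subst f t t',
     f_eq s t phi & f_eq s' t' psi]) \/
  (exists (i : 'I_m.+1) (s s' : M), [/\ term_subst f s s',
     f_gamma i s phi & f_gamma i s' psi]) \/
  (exists phi' psi' : M, [/\ sub f phi' psi', f_not phi' phi & f_not psi' psi]) \/
  (exists Phi Psi : M, [/\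
     forall phi' : M, phi' ∈ Phi -> exists2 psi' : M, psi' ∈ Psi & sub f phi' psi',
     forall psi' : M, psi' ∈ Psi -> exists2 phi' : M, phi' ∈ Phi & sub f phi' psi',
     f_and Phi phi & f_and Psi psi]) \/
  (exists I g phi' psi' : M, [/\ remove_vars I f g, sub g phi' psi',
     f_all I phi' phi & f_all I psi' psi]).

Definition triple_in (M : gb_structure) (a b c y : M) : Prop :=
  exists2 u : M, is_opair b c u & opair_in a u y.

(* No capture can occur, as the substituted terms are constants. *)
Definition is_subst (M : gb_structure) (m : nat) (f phi psi : M) : Prop :=
  exists2 w : M, triple_in f phi psi w &
    forall g phi' psi' : M, triple_in g phi' psi' w ->
      subst_step m (fun h phi0 psi0 => triple_in h phi0 psi0 w) g phi' psi'.

(** * Uniform forcing relations *)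

(* p forces the formula whose code is described by K. *)
Definition forces (M : gb_structure) (F : gclass M) (p : M) (K : M -> Prop) : Prop :=
  exists2 phi : M, K phi & opair_inc p phi F.

Definition names_mem (M : gb_structure) (sigma tau phi : M) : Prop :=
  exists s t : M, [/\ t_name sigma s, t_name tau t & f_mem s t phi].
Definition names_eq (M : gb_structure) (sigma tau phi : M) : Prop :=
  exists s t : M, [/\ t_name sigma s, t_name tau t & f_eq s t phi].
Definition name_gamma (M : gb_structure) (m : nat) (sigma : M) (i : 'I_m.+1)
    (phi : M) : Prop :=
  exists s : M, t_name sigma s /\ f_gamma i s phi.

Definition densely_below (M : gb_structure) (P : forcing_data M) (p : M)
    (D : M -> Prop) : Prop :=
  forall q' : M, fle P q' p -> exists2 q : M, fle P q q' & D q.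

Definition forces_subset (M : gb_structure) (P : forcing_data M) (F : gclass M)
    (p sigma tau : M) : Prop :=
  forall rho r q' : M, opair_in rho r sigma -> fle P q' p -> fle P q' r ->
    exists2 q : M, fle P q q' & forces F q (names_mem rho tau).

Record uniform_forcing_relation (M : gb_structure) (P : forcing_data M) (m : nat)
    (Gamma : 'I_m.+1 -> gclass M) (F : gclass M) : Prop := {
  ufr_domain : forall z : M, z ∈c F ->
    exists p phi : M, [/\ fcond P p, is_sentence P m phi & is_opair p phi z];
  ufr_mem : forall p sigma tau : M, fcond P p -> is_name P sigma -> is_name P tau ->
    (forces F p (names_mem sigma tau) <->
     densely_below P p (fun q => exists rho r : M,
       [/\ opair_in rho r tau, fle P q r & forces F q (names_eq sigma rho)]));
  ufr_eq : forall p sigma tau : M, fcond P p -> is_name P sigma -> is_name P tau ->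
    (forces F p (names_eq sigma tau) <->
     forces_subset P F p sigma tau /\ forces_subset P F p tau sigma);
  ufr_gamma : forall (p sigma : M) (i : 'I_m.+1), fcond P p -> is_name P sigma ->
    (forces F p (name_gamma sigma i) <->
     densely_below P p (fun q => exists tau r : M,
       [/\ opair_inc tau r (Gamma i), fle P q r & forces F q (names_eq sigma tau)]));
  ufr_and : forall p Phi : M, fcond P p ->
    (forall phi : M, phi ∈ Phi -> is_sentence P m phi) ->
    (forces F p (f_and Phi) <->
     forall phi : M, phi ∈ Phi -> opair_inc p phi F);
  ufr_not : forall p phi : M, fcond P p -> is_sentence P m phi ->
    (forces F p (f_not phi) <->
     ~ exists2 q : M, fle P q p & opair_inc q phi F);
  ufr_all : forall p I phi : M, fcond P p -> is_formula P m I phi ->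
    (forces F p (f_all I phi) <->
     forall f : M, name_sequence P I f -> forces F p (is_subst m f phi))
}.

(* Main.v *)
From mathcomp Require Import all_boot.
From Stdlib Require Import Classical FunctionalExtensionality PropExtensionality.
Require Import Defs.

(* For names, "p forces sigma = tau" only refers to equality of pairs of names of
   smaller rank, so it is defined by a recursion along the ordinals.  With it as
   a class parameter, a second recursion treats all sentences, along the rank
   of formulas: the clause for a quantifier refers to a proper class of
   instances, but substituting names for variables does not raise the rank of
   the formula, and each formula has only a set of immediate subformulas, so
   that its rank is an ordinal. *)

Set Implicit Arguments.
Unset Strict Implicit.
Unset Printing Implicit Defensive.

Local Open Scope gb_scope.

Existing Class GBC.

(** Membership in [M] may be ill-founded seen from outside, so no induction of the metatheory can
    run over sets, names or codes. Every such induction is foundation inside [M], applied to a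
    predicate defined by a formula; this is why definability accompanies the whole argument.
    [ETR_Ord] moreover admits one class parameter and no set parameter, so all parameters have to be
    packed into one class. Foundation speaks of immediate members only, whereas a name inside a name
    or a subformula inside a code lies a few membership steps deeper, because of Kuratowski pairs.
    The number of steps is bounded by a fixed constant, and [below_wf] extends foundation to such
    bounded descents. Equality comes first because the clause for membership keeps [sigma] and
    descends only in [tau]: both ranks drop only once that clause is inserted into the one for
    inclusion. In the second recursion the atomic formulas are then base cases, and the ranks of
    names do not enter the rank of a formula; a quantifier over all names could not bound them. *)

Lemma not_all_ex_not_imp (T : Type) (A B : T -> Prop) :
  ~ (forall x, A x -> B x) -> exists2 x, A x & ~ B x.
Proof.
move=> nAB; apply: NNPP => nex; apply: nAB => x Ax; apply: NNPP => nBx.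
by apply: nex; exists x.
Qed.

(** * Definability *)

Definition fo_ex (phi : fo_formula) : fo_formula := fo_not (fo_all (fo_not phi)).
Definition fo_or (phi psi : fo_formula) : fo_formula :=
  fo_not (fo_and (fo_not phi) (fo_not psi)).
Definition fo_iff (phi psi : fo_formula) : fo_formula :=
  fo_and (fo_not (fo_and phi (fo_not psi))) (fo_not (fo_and psi (fo_not phi))).

Definition fo_empty (i : nat) : fo_formula := fo_all (fo_not (fo_mem 0 i.+1)).
Definition fo_pair (i j k : nat) : fo_formula :=
  fo_all (fo_iff (fo_mem 0 k.+1) (fo_or (fo_eq 0 i.+1) (fo_eq 0 j.+1))).
Definition fo_opair (i j k : nat) : fo_formula :=
  fo_ex (fo_ex (fo_and (fo_pair i.+2 i.+2 1)
    (fo_and (fo_pair i.+2 j.+2 0) (fo_pair 1 0 k.+2)))).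

Section Definability.
Variable M : gb_structure.
Implicit Types (e : nat -> M) (E : nat -> gclass M).

Lemma sat_ex e E phi :
  fo_sat e E (fo_ex phi) <-> exists x : M, fo_sat (env_cons x e) E phi.
Proof.
split=> /= [nall|[x phix] nall]; last exact: (nall x).
by apply: NNPP => nex; apply: nall => x phix; apply: nex; exists x.
Qed.

Lemma sat_and e E phi psi :
  fo_sat e E (fo_and phi psi) <-> fo_sat e E phi /\ fo_sat e E psi.
Proof. by []. Qed.

Lemma sat_or e E phi psi :
  fo_sat e E (fo_or phi psi) <-> fo_sat e E phi \/ fo_sat e E psi.
Proof. by rewrite /=; tauto. Qed.

Lemma sat_pair e E i j k :
  fo_sat e E (fo_pair i j k) <-> is_pair (e i) (e j) (e k).
Proof.
by split=> H z; have := H z => /=; tauto.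
Qed.

Lemma sat_opair e E i j k :
  fo_sat e E (fo_opair i j k) <-> is_opair (e i) (e j) (e k).
Proof.
rewrite sat_ex; split=> [[u /sat_ex[v]]|[u [v [Hu Hv Hk]]]].
  by rewrite !sat_and !sat_pair => -[Hu [Hv Hk]]; exists u, v.
by exists u; rewrite sat_ex; exists v; rewrite !sat_and !sat_pair.
Qed.

(* Class variable 0 is the variable class of a recursion on classes; all the
   others denote the single parameter A, as in ETR_Ord. *)
Definition class_env (A R : gclass M) (k : nat) : gclass M :=
  if k is 0 then R else A.

(** One formula has to serve all [R] and [e], because in a recursion it is fixed before the
    restrictions at which it is evaluated. *)
Definition definable_from (A : gclass M) (D : gclass M -> (nat -> M) -> Prop) :=
  exists phi, forall R e, fo_sat e (class_env A R) phi <-> D R e.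

Definition definable (D : gclass M -> (nat -> M) -> Prop) :=
  exists A, definable_from A D.

(** Each atom about [A] is replaced by a formula over [B], while class variable 0 stays, as it
    denotes [R] on both sides. This lets a merged class stand for either of its components. *)
Lemma definable_from_trans (A B : gclass M) :
  (forall i, definable_from B (fun R e => e i ∈c A)) ->
  forall D, definable_from A D -> definable_from B D.
Proof.
move=> AB D [phi phiD].
have [psi psiP] : definable_from B (fun R e => fo_sat e (class_env A R) phi).
  elim: phi {D phiD} => [i j|i j|i [|k]|phi [psi H]|phi [psi H] phi' [psi' H']|phi [psi H]].
  - by exists (fo_eq i j).
  - by exists (fo_mem i j).
  - by exists (fo_cmem i 0).
  - exact: AB.
  - by exists (fo_not psi) => R e /=; rewrite H.
  - by exists (fo_and psi psi') => R e /=; rewrite H H'.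
  - by exists (fo_all psi) => R e /=; split=> HH x; apply/H/HH.
by exists psi => R e; rewrite psiP phiD.
Qed.

(** Besides variables, terms include arbitrary sets of [M], which a formula cannot mention directly;
    [definable_param] absorbs them into the class parameter. *)
Inductive definable_term : ((nat -> M) -> M) -> Prop :=
  | definable_var i : definable_term (fun e => e i)
  | definable_const c : definable_term (fun=> c).

Lemma definable_shift a (f : nat -> nat) :
  definable_term a -> definable_term (fun e => a (fun n => e (f n))).
Proof. by case=> [i|c]; [apply: (definable_var (f i))|apply: definable_const]. Qed.

Context {hM : GBC M}.

Lemma set_ext (x y : M) : (forall z, z ∈ x <-> z ∈ y) -> x = y.
Proof. exact: gbc_set_ext. Qed.

Lemma pair_ex (a b : M) : exists c, is_pair a b c.
Proof. exact: gbc_pairing. Qed.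

Lemma opair_ex (a b : M) : exists c, is_opair a b c.
Proof.
have [u Hu] := pair_ex a a; have [v Hv] := pair_ex a b.
by have [c Hc] := pair_ex u v; exists c, u, v.
Qed.

Lemma pair_inj (a b c d x : M) : is_pair a b x -> is_pair c d x ->
  (a = c /\ b = d) \/ (a = d /\ b = c).
Proof.
move=> H1 H2.
have := (H2 a).1 ((H1 a).2 (or_introl erefl)).
have := (H2 b).1 ((H1 b).2 (or_intror erefl)).
have := (H1 c).1 ((H2 c).2 (or_introl erefl)).
have := (H1 d).1 ((H2 d).2 (or_intror erefl)).
by intuition congruence.
Qed.

Lemma pair_uniq (a b x y : M) : is_pair a b x -> is_pair a b y -> x = y.
Proof. by move=> H1 H2; apply: set_ext => z; rewrite H1 H2. Qed.

Lemma opair_inj (a b c d x : M) : is_opair a b x -> is_opair c d x ->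
  a = c /\ b = d.
Proof.
move=> [u [v [Hu Hv Hx]]] [u' [v' [Hu' Hv' Hx']]].
case: (pair_inj Hx Hx') => -[e1 e2]; subst.
  have [] := pair_inj Hu Hu'; have [] := pair_inj Hv Hv'; intuition congruence.
have [] := pair_inj Hu Hv'; have [] := pair_inj Hv Hu'; intuition congruence.
Qed.

Lemma opair_uniq (a b x y : M) : is_opair a b x -> is_opair a b y -> x = y.
Proof.
move=> [u [v [Hu Hv Hx]]] [u' [v' [Hu' Hv' Hy]]].
rewrite -(pair_uniq Hu Hu') -(pair_uniq Hv Hv') in Hy.
exact: pair_uniq Hx Hy.
Qed.

Lemma empty_ex : exists x : M, empty x.
Proof. by have [w [[x Hx _] _]] := gbc_infinity hM; exists x. Qed.

Lemma pair_nonempty (a b c : M) : is_pair a b c -> ~ empty c.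
Proof. by move=> H /(_ a); apply; apply/H; left. Qed.


(* A1 and A2 are stored in A with distinct tags, the tag of A1 being empty. *)
Lemma class_merge (A1 A2 : gclass M) : exists A,
  (forall x, x ∈c A1 <-> exists a z, [/\ empty a, is_opair a x z & z ∈c A]) /\
  (forall x, x ∈c A2 <-> exists a z, [/\ ~ empty a, is_opair a x z & z ∈c A]).
Proof.
have [o Ho] := empty_ex.
have [i Hi] := pair_ex o o; have {}Hi := pair_nonempty Hi.
pose phi := fo_ex (fo_ex (fo_and (fo_opair 1 0 2) (fo_or
  (fo_and (fo_empty 1) (fo_cmem 0 0))
  (fo_and (fo_not (fo_empty 1)) (fo_cmem 0 1))))).
have [A HA] := gbc_comprehension hM phi (fun=> o) (class_env A2 A1).
have {}HA z : z ∈c A <-> exists a x, is_opair a x z /\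
    ((empty a /\ x ∈c A1) \/ (~ empty a /\ x ∈c A2)).
  rewrite HA sat_ex; split=> [[a]|[a [x [H1 H2]]]].
    by rewrite sat_ex => -[x]; rewrite sat_and sat_opair sat_or; exists a, x.
  by exists a; rewrite sat_ex; exists x; rewrite sat_and sat_opair sat_or.
exists A; split=> x; split.
- by move=> Hx; have [z Hz] := opair_ex o x; exists o, z; split=> //;
    apply/HA; exists o, x; tauto.
- by case=> a [z [Ha Hz /HA[b [y [/(opair_inj Hz)[<- <-]]]]]]; tauto.
- by move=> Hx; have [z Hz] := opair_ex i x; exists i, z; split=> //;
    apply/HA; exists i, x; tauto.
- by case=> a [z [Ha Hz /HA[b [y [/(opair_inj Hz)[<- <-]]]]]]; tauto.
Qed.

Lemma definable_iff D D' :
  (forall R e, D R e <-> D' R e) -> definable D' -> definable D.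
Proof. by move=> DD' [A [phi H]]; exists A, phi => R e; rewrite DD'. Qed.

Lemma definable_not D : definable D -> definable (fun R e => ~ D R e).
Proof. by move=> [A [phi H]]; exists A, (fo_not phi) => R e /=; rewrite H. Qed.

Lemma definable_all (D : M -> gclass M -> (nat -> M) -> Prop) :
  definable (fun R e => D (e 0) R (fun n => e n.+1)) ->
  definable (fun R e => forall x, D x R e).
Proof.
move=> [A [phi H]]; exists A, (fo_all phi) => R e /=.
by split=> HH x; have := HH x; rewrite H.
Qed.

Lemma definable_and D D' :
  definable D -> definable D' -> definable (fun R e => D R e /\ D' R e).
Proof.
move=> [A1 H1] [A2 H2]; have [A [HA1 HA2]] := class_merge A1 A2.
have [phi Hphi] : definable_from A D.
  apply: definable_from_trans H1 => i.
  exists (fo_ex (fo_ex (fo_and (fo_empty 1) (fo_and (fo_opair 1 i.+2 0) (fo_cmem 0 1))))) => R e.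
  rewrite HA1 sat_ex; split=> [[a]|[a [z [H1 H3 H4]]]].
    by rewrite sat_ex => -[z]; rewrite !sat_and sat_opair => -[Ha [Hz HA]]; exists a, z.
  by exists a; rewrite sat_ex; exists z; rewrite !sat_and sat_opair.
have [psi Hpsi] : definable_from A D'.
  apply: definable_from_trans H2 => i.
  exists (fo_ex (fo_ex (fo_and (fo_not (fo_empty 1)) (fo_and (fo_opair 1 i.+2 0) (fo_cmem 0 1))))) => R e.
  rewrite HA2 sat_ex; split=> [[a]|[a [z [H2 H3 H4]]]].
    by rewrite sat_ex => -[z]; rewrite !sat_and sat_opair => -[Ha [Hz HA]]; exists a, z.
  by exists a; rewrite sat_ex; exists z; rewrite !sat_and sat_opair.
by exists A, (fo_and phi psi) => R e /=; rewrite Hphi Hpsi.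
Qed.

Lemma definable_imp D D' :
  definable D -> definable D' -> definable (fun R e => D R e -> D' R e).
Proof.
move=> H1 H2; apply: (definable_iff _ (definable_not (definable_and H1 (definable_not H2)))).
by move=> R e; tauto.
Qed.

Lemma definable_or D D' :
  definable D -> definable D' -> definable (fun R e => D R e \/ D' R e).
Proof.
move=> H1 H2; apply: (definable_iff _ (definable_imp (definable_not H1) H2)).
by move=> R e; tauto.
Qed.

Lemma definable_equiv D D' :
  definable D -> definable D' -> definable (fun R e => D R e <-> D' R e).
Proof. by move=> H1 H2; apply: definable_and; apply: definable_imp. Qed.

Lemma definable_ex (D : M -> gclass M -> (nat -> M) -> Prop) :
  definable (fun R e => D (e 0) R (fun n => e n.+1)) ->
  definable (fun R e => exists x, D x R e).
Proof.
move=> H; apply: (@definable_iff _ (fun R e => ~ forall x, ~ D x R e)).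
  by move=> R e; split=> [[x Dx] /(_ x)//|H']; apply: not_all_not_ex.
exact/definable_not/(@definable_all (fun x R e => ~ D x R e))/definable_not.
Qed.

Lemma definable_ex2 (D D' : M -> gclass M -> (nat -> M) -> Prop) :
  definable (fun R e => D (e 0) R (fun n => e n.+1)) ->
  definable (fun R e => D' (e 0) R (fun n => e n.+1)) ->
  definable (fun R e => exists2 x, D x R e & D' x R e).
Proof.
move=> H H'; apply: (@definable_iff _ (fun R e => exists x, D x R e /\ D' x R e)).
  by move=> R e; split=> [[x ? ?]|[x [? ?]]]; exists x.
exact/(@definable_ex (fun x R e => D x R e /\ D' x R e))/definable_and.
Qed.

Lemma definable_and3 D1 D2 D3 : definable D1 -> definable D2 -> definable D3 ->
  definable (fun R e => [/\ D1 R e, D2 R e & D3 R e]).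
Proof.
move=> H1 H2 H3.
apply: (definable_iff _ (definable_and H1 (definable_and H2 H3))) => R e.
by split=> [[]|[? []]].
Qed.

Lemma definable_and4 D1 D2 D3 D4 :
  definable D1 -> definable D2 -> definable D3 -> definable D4 ->
  definable (fun R e => [/\ D1 R e, D2 R e, D3 R e & D4 R e]).
Proof.
move=> H1 H2 H3 H4.
apply: (definable_iff _ (definable_and H1 (definable_and3 H2 H3 H4))) => R e.
by split=> [[]|[? []]].
Qed.



Lemma class_inhabited : exists A : gclass M, True.
Proof. by have [A] := gbc_global_choice hM; exists A. Qed.

(** The set [c] enters through its singleton class, which is a legitimate class parameter and can be
    merged with the others. *)
Lemma definable_param c (D : M -> gclass M -> (nat -> M) -> Prop) :
  definable (fun R e => D (e 0) R (fun n => e n.+1)) ->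
  definable (fun R e => D c R e).
Proof.
move=> H; have [A _] := class_inhabited.
have [C HC] := gbc_comprehension hM (fo_eq 0 1) (fun=> c) (fun=> A).
apply: (@definable_iff _ (fun R e => exists2 x, x ∈c C & D x R e)).
  move=> R e; split=> [Dc|[x /HC/= -> //]]; exists c => //; exact/HC.
by apply: (@definable_ex2 (fun x _ _ => x ∈c C)) => //; exists C, (fo_cmem 0 1).
Qed.

Lemma definable_eq a b :
  definable_term a -> definable_term b -> definable (fun _ e => a e = b e).
Proof.
have [A _] := class_inhabited.
case=> [i|c] [j|d]; first by exists A, (fo_eq i j).
- by apply: (@definable_param _ (fun x _ e => e i = x)); exists A, (fo_eq i.+1 0).
- by apply: (@definable_param _ (fun x _ e => x = e j)); exists A, (fo_eq 0 j.+1).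
apply: (@definable_param _ (fun x _ _ => x = d)).
by apply: (@definable_param _ (fun x _ e => e 0 = x)); exists A, (fo_eq 1 0).
Qed.

Lemma definable_mem a b :
  definable_term a -> definable_term b -> definable (fun _ e => a e ∈ b e).
Proof.
have [A _] := class_inhabited.
case=> [i|c] [j|d]; first by exists A, (fo_mem i j).
- by apply: (@definable_param _ (fun x _ e => e i ∈ x)); exists A, (fo_mem i.+1 0).
- by apply: (@definable_param _ (fun x _ e => x ∈ e j)); exists A, (fo_mem 0 j.+1).
apply: (@definable_param _ (fun x _ _ => x ∈ d)).
by apply: (@definable_param _ (fun x _ e => e 0 ∈ x)); exists A, (fo_mem 1 0).
Qed.

Lemma definable_cmem a A : definable_term a -> definable (fun _ e => a e ∈c A).
Proof.
case=> [i|c]; first by exists A, (fo_cmem i 1).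
by apply: (@definable_param _ (fun x _ _ => x ∈c A)); exists A, (fo_cmem 0 1).
Qed.

Lemma definable_rmem a : definable_term a -> definable (fun R e => a e ∈c R).
Proof.
have [A _] := class_inhabited.
case=> [i|c]; first by exists A, (fo_cmem i 0).
by apply: (@definable_param _ (fun x R _ => x ∈c R)); exists A, (fo_cmem 0 0).
Qed.

(** The indices of the class names live in the metatheory, not in [M]; quantifying over finitely
    many of them is a finite disjunction. *)
Lemma definable_ex_fin (T : finType) (D : T -> gclass M -> (nat -> M) -> Prop) :
  (forall i, definable (D i)) -> definable (fun R e => exists i, D i R e).
Proof.
move=> H.
suff Hs (s : seq T) : definable (fun R e => exists2 i, i \in s & D i R e).
  apply: (definable_iff _ (Hs (enum T))) => R e.
  by split=> [[i Di]|[i _ Di]]; exists i => //; rewrite mem_enum.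
elim: s => [|i s IHs].
  have [o _] := empty_ex.
  apply: (definable_iff _ (definable_not (definable_eq (definable_const o) (definable_const o)))).
  by move=> R e; split=> [[]|].
apply: (definable_iff _ (definable_or (H i) IHs)) => R e; split=> [[j]|].
  by rewrite inE => /orP[/eqP->|js] Dj; [left|right; exists j].
by case=> [Di|[j js Dj]]; [exists i|exists j] => //; rewrite inE ?eqxx ?js ?orbT.
Qed.

End Definability.

(** The order of cases matters: quantifiers over ['I_n] are caught before those over sets, and the
    recursion variable [R] before class parameters. *)
Ltac definable_step :=
  lazymatch goal with
  | |- definable_term (fun e => e _) => apply: definable_var
  | |- definable_term (fun e => ?a (fun n => e (@?f n))) => refine (@definable_shift _ a f _)
  | |- definable_term ?a => first [assumption | apply: definable_const]
  | |- definable (fun R e => ~ _) => apply: definable_not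
  | |- definable (fun R e => _ /\ _) => apply: definable_and
  | |- definable (fun R e => _ \/ _) => apply: definable_or
  | |- definable (fun R e => _ <-> _) => apply: definable_equiv
  | |- definable (fun R e => [/\ _, _ & _]) => apply: definable_and3
  | |- definable (fun R e => [/\ _, _, _ & _]) => apply: definable_and4
  | |- definable (fun R e => _ = _) => apply: definable_eq
  | |- definable (fun R e => _ ∈ _) => apply: definable_mem
  | |- definable (fun R e => _ ∈c R) => apply: definable_rmem
  | |- definable (fun R e => _ ∈c _) => apply: definable_cmem
  | |- definable (fun R e => exists x : 'I__, @?D R e x) =>
      refine (@definable_ex_fin _ _ _ (fun x R e => D R e x) _); intro; cbv beta
  | |- definable (fun R e => exists x, @?D R e x) =>
      refine (@definable_ex _ (fun x R e => D R e x) _); cbv beta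
  | |- definable (fun R e => exists2 x, @?D R e x & @?D' R e x) =>
      refine (@definable_ex2 _ _ (fun x R e => D R e x) (fun x R e => D' R e x) _ _); cbv beta
  | |- definable (fun R e => forall x : gset _, @?D R e x) =>
      refine (@definable_all _ (fun x R e => D R e x) _); cbv beta
  | |- definable (fun R e => _ -> _) => apply: definable_imp
  end.
Ltac definability_core := repeat first [assumption | definable_step].


(** * Definability of pairs, ordinals, numerals and names *)

Section DefinableNotions.
Context {M : gb_structure} {hM : GBC M}.
Variables a b c : (nat -> M) -> M.
Hypotheses (da : definable_term a) (db : definable_term b) (dc : definable_term c).

Lemma definable_is_pair : definable (fun _ e => is_pair (a e) (b e) (c e)).
Proof. by rewrite /is_pair; definability_core. Qed.

Lemma definable_is_opair : definable (fun _ e => is_opair (a e) (b e) (c e)).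
Proof. by rewrite /is_opair /is_pair; definability_core. Qed.

Lemma definable_opair_in : definable (fun _ e => opair_in (a e) (b e) (c e)).
Proof. by rewrite /opair_in /is_opair /is_pair; definability_core. Qed.

Lemma definable_opair_inc A : definable (fun _ e => opair_inc (a e) (b e) A).
Proof. by rewrite /opair_inc /is_opair /is_pair; definability_core. Qed.

Lemma definable_opair_inr : definable (fun R e => opair_inc (a e) (b e) R).
Proof. by rewrite /opair_inc /is_opair /is_pair; definability_core. Qed.

Lemma definable_is_ordinal : definable (fun _ e => is_ordinal (a e)).
Proof. by rewrite /is_ordinal /transitive_set; definability_core. Qed.

Lemma definable_is_numeral n : definable (fun _ e => is_numeral n (a e)).
Proof.
elim: n a da => [|n IHn] x dx /=; first by rewrite /empty; definability_core.
by rewrite /is_succ; definability_core; apply: IHn; definability_core.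
Qed.

Lemma definable_is_name P : definable (fun _ e => is_name P (a e)).
Proof.
by rewrite /is_name /fcond /is_opair /is_pair; definability_core.
Qed.

End DefinableNotions.

Ltac definable_notion :=
  lazymatch goal with
  | |- definable (fun R e => is_pair _ _ _) => apply: definable_is_pair
  | |- definable (fun R e => is_opair _ _ _) => apply: definable_is_opair
  | |- definable (fun R e => opair_in _ _ _) => apply: definable_opair_in
  | |- definable (fun R e => opair_inc _ _ R) => apply: definable_opair_inr
  | |- definable (fun R e => opair_inc _ _ _) => apply: definable_opair_inc
  | |- definable (fun R e => is_ordinal _) => apply: definable_is_ordinal
  | |- definable (fun R e => is_numeral _ _) => apply: definable_is_numeral
  | |- definable (fun R e => is_name _ _) => apply: definable_is_name
  end.

Ltac definable_unfold := progress
  (unfold fcond, fle, empty, is_succ, is_union2, triple_in, densely_below,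
     tagged, tagged2, t_var, t_name, f_mem, f_eq, f_gamma, f_not, f_and, f_all,
     is_term, formula_step, is_formula, is_sentence, name_sequence, term_subst,
     remove_vars, subst_step, is_subst, unique, names_mem, names_eq, name_gamma; cbv beta).

(** Quantifying over the term [a] makes the property usable at any quantifier depth, where the
    argument of [Q] is a shifted variable. *)
Definition definable1 (M : gb_structure) (Q : gclass M -> M -> Prop) :=
  forall a, definable_term a -> definable (fun R e => Q R (a e)).
Definition definable2 (M : gb_structure) (Q : gclass M -> M -> M -> Prop) :=
  forall a b, definable_term a -> definable_term b ->
    definable (fun R e => Q R (a e) (b e)).

Ltac definability := repeat first
  [ assumption | definable_notion | definable_step
  | match goal with
    | H : definable1 _ |- definable _ => apply H
    | H : definable2 _ |- definable _ => apply H
    | |- definable1 _ => do 2 intro; cbv beta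
    | |- definable2 _ => do 4 intro; cbv beta
    end
  | definable_unfold].

(** * Set theory inside the model *)

Section Sets.
Context {M : gb_structure} {hM : GBC M}.
Implicit Types (a b c x y z : M) (X : gclass M).

Lemma comprehension (Q : M -> Prop) : definable1 (fun=> Q) ->
  exists X, forall x, x ∈c X <-> Q x.
Proof.
move=> /(_ _ (definable_var M 0))[A [phi Hphi]]; have [o _] := empty_ex.
have [X HX] := gbc_comprehension hM phi (fun=> o) (class_env A A).
by exists X => x; rewrite HX Hphi.
Qed.

Lemma comprehension2 (Q : M -> M -> Prop) : definable2 (fun=> Q) ->
  exists X, forall x y, opair_inc x y X <-> Q x y.
Proof.
move=> dQ.
have [|X HX] := comprehension (Q := fun z => exists x y, is_opair x y z /\ Q x y).
  by definability.
exists X => x y; split.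
  by case=> z xyz /HX[x' [y' [/(opair_inj xyz)[<- <-]]]].
by move=> Qxy; have [z xyz] := opair_ex x y; exists z => //; apply/HX; exists x, y.
Qed.

Lemma image_ex (Q : M -> M -> Prop) : definable2 (fun=> Q) ->
  (forall x y y', Q x y -> Q x y' -> y = y') ->
  forall a, exists b, forall y, y ∈ b <-> exists2 x, x ∈ a & Q x y.
Proof.
move=> dQ Qfun a; have [F HF] := comprehension2 dQ.
have [|b Hb] := gbc_replacement hM (F := F) _ a.
  by move=> x y y' /HF Hy /HF; apply: Qfun.
by exists b => y; rewrite Hb; split=> -[x xa /HF Hx]; exists x.
Qed.

Lemma separation (Q : M -> Prop) : definable1 (fun=> Q) ->
  forall a, exists b, forall x, x ∈ b <-> x ∈ a /\ Q x.
Proof.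
(* Separation is replacement along the identity restricted to [Q]. *)
move=> dQ a; have [||b Hb] := image_ex (Q := fun x y => Q x /\ x = y) _ _ a.
- by definability.
- by move=> x y y' [_ <-] [_ <-].
by exists b => x; rewrite Hb; split=> [[y ya [Qy <-]]|[xa Qx]] //; exists x.
Qed.

Lemma union2_ex a b : exists c, is_union2 a b c.
Proof.
have [d Hd] := pair_ex a b; have [c Hc] := gbc_union hM d; exists c => z.
rewrite Hc; split=> [[y /Hd[]->]|[]]; [by left|by right| |].
  by exists a => //; apply/Hd; left.
by exists b => //; apply/Hd; right.
Qed.

Lemma singleton_ex a : exists b, forall z, z ∈ b <-> z = a.
Proof. by have [b Hb] := pair_ex a a; exists b => z; rewrite Hb; tauto. Qed.

Lemma succ_ex a : exists b, is_succ a b.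
Proof.
have [s Hs] := singleton_ex a; have [b Hb] := union2_ex a s.
by exists b => z; rewrite Hb Hs.
Qed.

Lemma succ_uniq a b c : is_succ a b -> is_succ a c -> b = c.
Proof. by move=> H H'; apply: set_ext => z; rewrite H H'. Qed.

Lemma union2_uniq a b c d : is_union2 a b c -> is_union2 a b d -> c = d.
Proof. by move=> H H'; apply: set_ext => z; rewrite H H'. Qed.

Lemma empty_uniq a b : empty a -> empty b -> a = b.
Proof. by move=> Ha Hb; apply: set_ext => z; split=> [/Ha|/Hb]. Qed.

Lemma mem_irrefl a : ~ a ∈ a.
Proof.
move=> aa; have [s Hs] := singleton_ex a.
have [|x /Hs-> /(_ a aa)] := gbc_foundation hM (a := s).
  by move=> /(_ a); apply; apply/Hs.
by apply; apply/Hs.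
Qed.

(* y is a member of x, or a member of a member of x, and so on, k times at most. *)
Fixpoint below (k : nat) y x : Prop :=
  if k is k'.+1 then y ∈ x \/ exists2 u, u ∈ x & below k' y u else False.

Lemma definable_below k : definable2 (fun _ : gclass M => below k).
Proof.
elim: k => [|k IHk] a b da db /=; last by definability; apply: IHk; definability.
have [o _] := @empty_ex M hM.
apply: (@definable_iff _ _ (fun R e => ~ (o = o))); first by tauto.
by definability.
Qed.

(* Adding to b the members of its elements that lie above some element of b
   shortens the descending chains by one. *)
Lemma below_wf k b :
  (forall x, x ∈ b -> exists2 y, y ∈ b & below k y x) -> empty b.
Proof.
case: k => [|k] in b *; first by move=> H x /H[].
elim: k => [|k IHk] in b * => H.
  apply: NNPP => /(gbc_foundation hM)[x xb xmin].
  by have [y yb [/xmin//|[]]] := H x xb.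
have [u Hu] := gbc_union hM b.
have db := @definable_below k.+1.
have [|s Hs] := separation (Q := fun z => exists2 y, y ∈ b & below k.+1 y z) _ u.
  by definability.
have [c Hc] := union2_ex b s.
suff c0 : empty c by move=> z zb; apply: (c0 z); apply/Hc; left.
apply: IHk => x /Hc[xb|/Hs[_ [y yb yx]]]; last by exists y => //; apply/Hc; left.
have [y yb [yx|[z zx yz]]] := H x xb.
  by exists y; [apply/Hc; left|left].
exists z; last by left.
by apply/Hc; right; apply/Hs; split; [apply/Hu; exists x|exists y].
Qed.

(** * Ordinals *)

Lemma ordinal_mem a b : is_ordinal a -> b ∈ a -> is_ordinal b.
Proof.
move=> [aT aE] ba; split; first exact: aE.
by move=> c cb; apply: aE; apply: aT cb.
Qed.

(** The counterexamples in [a] form a set by separation, and foundation gives a minimal one; this is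
    where definability of [Q] enters. *)
Lemma ordinal_ind (Q : M -> Prop) : definable1 (fun=> Q) ->
  (forall a, is_ordinal a -> (forall b, b ∈ a -> Q b) -> Q a) ->
  forall a, is_ordinal a -> Q a.
Proof.
move=> dQ IH a aO; apply: NNPP => nQa.
have [|c Hc] := separation (Q := fun x => ~ Q x) _ a; first by definability.
have [|b /Hc[ba nQb] bmin] := gbc_foundation hM (a := c).
  move=> c0; apply: nQa; apply: IH => // b ba; apply: NNPP => nQb.
  by apply: (c0 b); apply/Hc.
apply: nQb; apply: IH => [|d db]; first exact: ordinal_mem ba.
by apply: NNPP => nQd; apply: (bmin d db); apply/Hc; split=> //; apply: aO.1 db.
Qed.

Lemma ordinal_trichotomy a b : is_ordinal a -> is_ordinal b ->
  a ∈ b \/ a = b \/ b ∈ a.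
Proof.
move=> aO; move: a aO b.
apply: (@ordinal_ind (fun a => forall b, is_ordinal b -> a ∈ b \/ a = b \/ b ∈ a)).
  by definability.
move=> a aO IHa; apply: ordinal_ind; first by definability.
move=> b bO IHb.
have [ab|nab] := classic (a ∈ b); first by left.
have [ba|nba] := classic (b ∈ a); first by right; right.
right; left; apply: set_ext => z; split=> [za|zb].
  have [//|[eq_zb|bz]] := IHa z za b bO; first by case: nba; rewrite -eq_zb.
  by case: nba; apply: aO.1 bz.
have [az|[eq_az|//]] := IHb z zb; first by case: nab; apply: bO.1 az.
by case: nab; rewrite eq_az.
Qed.

Lemma ordinal_least (Q : M -> Prop) : definable1 (fun=> Q) ->
  forall a, is_ordinal a -> Q a ->
  exists b, [/\ is_ordinal b, Q b & forall c, c ∈ b -> ~ Q c].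
Proof.
move=> dQ a aO Qa; apply: NNPP => nex; move: a aO Qa.
apply: (@ordinal_ind (fun a => ~ Q a)); first by definability.
by move=> a aO IHa Qa; apply: nex; exists a.
Qed.

Lemma ordinal_succ a b : is_ordinal a -> is_succ a b -> is_ordinal b.
Proof.
move=> aO Hb; split=> [x y /Hb[xa|->] yx|x /Hb[xa|->]]; last exact: aO.1.
- by apply/Hb; left; apply: aO.1 yx.
- by apply/Hb; left.
exact: aO.2.
Qed.

Lemma ordinal_union a b : (forall x, x ∈ a -> is_ordinal x) ->
  (forall z, z ∈ b <-> exists2 y, y ∈ a & z ∈ y) -> is_ordinal b.
Proof.
move=> aO Hb; split=> [x y /Hb[z za xz] yx|x /Hb[z za xz]].
  by apply/Hb; exists z => //; apply: (aO z za).1 yx.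
exact: (aO z za).2.
Qed.
End Sets.

(** * Recursion along ranks *)

Section Ranks.
Context {M : gb_structure} {hM : GBC M}.
Hypothesis hETR : ETR_Ord M.
Implicit Types (a b c x y z : M) (R S : gclass M).

Lemma etr (Q : (M -> M -> Prop) -> M -> Prop) :
  definable (fun R e => Q (fun b y => opair_inc b y R) (e 0)) ->
  exists S, forall a, is_ordinal a -> forall x, opair_inc a x S <->
    Q (fun b y => b ∈ a /\ opair_inc b y S) x.
Proof.
move=> [A [phi Hphi]]; have [S [_ HS]] := hETR phi A; exists S => a aO x.
have [|R HR] := comprehension (Q := fun z => z ∈c S /\
  exists b y, b ∈ a /\ is_opair b y z); first by definability.
rewrite (HS a aO R HR) -/(class_env A R) Hphi.
(* [Q] is an arbitrary operator on relations, so the pointwise equivalence of its two arguments has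
   to be turned into an equality. *)
suff -> : (fun b y => opair_inc b y R) = (fun b y => b ∈ a /\ opair_inc b y S) by [].
apply: functional_extensionality => b; apply: functional_extensionality => y.
apply: propositional_extensionality; split=> [[z Hz /HR[zS [b' [y' [b'a]]]]]|[ba [z Hz zS]]].
  by move=> /(opair_inj Hz)[eq_b _]; rewrite -eq_b in b'a; split=> //; exists z.
by exists z => //; apply/HR; split=> //; exists b, y.
Qed.

Definition ranked R x : Prop := exists2 a, is_ordinal a & opair_inc a x R.

(** Upper bounds instead of exact ranks: [opair_inc a x R] means that [x] has a [D]-rank and that it
    is at most [a]. In this form the rank relation is itself the solution of a recursion of length
    Ord. *)
Definition ranks (D : M -> M -> Prop) R : Prop := forall a, is_ordinal a ->
  forall x, opair_inc a x R <->
    forall y, D y x -> exists2 b, b ∈ a & opair_inc b y R.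

Lemma ranks_ex (D : M -> M -> Prop) : definable2 (fun=> D) -> exists R, ranks D R.
Proof.
move=> dD.
have [|R HR] := etr (Q := fun X x => forall y, D y x -> exists b, X b y).
  by definability.
exists R => a aO x; rewrite HR //; split=> H y /H; first by case=> b [? ?]; exists b.
by case=> b ? ?; exists b.
Qed.

Lemma definable_ranked R : definable1 (fun=> ranked R).
Proof. by rewrite /ranked; definability. Qed.

(** The bound is the supremum of the successors of least ranks; choosing least ranks makes the
    assignment functional, as replacement demands. *)
Lemma ranked_sup R d : exists2 a, is_ordinal a &
  forall y, y ∈ d -> ranked R y -> exists2 b, b ∈ a & opair_inc b y R.
Proof.
pose least b y := [/\ is_ordinal b, opair_inc b y R & forall c, c ∈ b -> ~ opair_inc c y R].
have [||s Hs] := image_ex (Q := fun y c => exists2 b, least b y & is_succ b c) _ _ d.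
- by rewrite /least; definability.
- move=> y c c' [b [bO by1 b1] Hc] [b' [b'O b'y b'1] Hc'].
  have eq_b : b = b'.
    by have [/b'1|[|/b1]] := ordinal_trichotomy bO b'O.
  by rewrite -eq_b in Hc'; apply: succ_uniq Hc Hc'.
have [a Ha] := gbc_union hM s; exists a.
  apply: ordinal_union Ha => c /Hs[y _ [b [bO _ _]]]; exact: ordinal_succ.
move=> y yd [b bO bY].
have [|b' [b'O b'y b'1]] := ordinal_least (Q := fun b => opair_inc b y R) _ bO bY.
  by definability.
have [c Hc] := succ_ex b'.
exists b' => //; apply/Ha; exists c; last by apply/Hc; right.
by apply/Hs; exists y => //; exists b'.
Qed.

(** If all predecessors of [x] were ranked, [ranked_sup] would bound them within [t] and [x] would
    be ranked too. So each unranked element of [t] has an unranked one at most [k] steps below it,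
    and [below_wf] shows that there is none. *)
Lemma ranked_closed D R k t : ranks D R ->
  (forall x y, x ∈ t -> D y x -> y ∈ t /\ below k y x) ->
  forall x, x ∈ t -> ranked R x.
Proof.
move=> HR Ht.
have dR := @definable_ranked R.
have [|b Hb] := separation (Q := fun x => ~ ranked R x) _ t; first by definability.
suff b0 : empty b by move=> x xt; apply: NNPP => nx; apply: (b0 x); apply/Hb.
apply: (@below_wf _ _ k) => x /Hb[xt nx].
have [y Dyx ny] : exists2 y, D y x & ~ ranked R y.
  apply: not_all_ex_not_imp => H; apply: nx.
  have [a aO Ha] := ranked_sup R t; exists a => //; apply/(HR a aO) => y Dyx.
  by apply: Ha; [exact: (Ht x y xt Dyx).1|exact: H].
by have [yt yx] := Ht x y xt Dyx; exists y => //; apply/Hb.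
Qed.

(** The second hypothesis is locality: at an object bounded by [a] the operator consults only
    objects bounded below [a]. [R] is a parameter so that codes of pairs and triples can be ranked
    through their components. *)
Lemma ranked_recursion R (Q : (M -> Prop) -> M -> Prop) :
  (forall X, definable1 X -> definable (fun S e => Q (X S) (e 0))) ->
  (forall a x X Y, is_ordinal a -> opair_inc a x R ->
     (forall b y, b ∈ a -> opair_inc b y R -> (X y <-> Y y)) -> Q X x -> Q Y x) ->
  exists T : gclass M, forall x, ranked R x -> (x ∈c T <-> Q (fun y => y ∈c T) x).
Proof.
move=> dQ Qloc.
(* Exact ranks: the recursion fills in a stage for every ordinal and every [x], but only the stage
   at the rank of [x] will be read. *)
pose rk a x := [/\ is_ordinal a, opair_inc a x R & forall b, b ∈ a -> ~ opair_inc b x R].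
have drk : definable2 (fun=> rk) by rewrite /rk; definability.
have rk_uniq a b x : rk a x -> rk b x -> a = b.
  move=> [aO ax amin] [bO bx bmin].
  by have [/bmin|[|/amin]] := ordinal_trichotomy aO bO.
have rk_ex x : ranked R x -> exists a, rk a x.
  move=> [a aO ax]; apply: (ordinal_least (Q := fun a => opair_inc a x R)) ax => //.
  by definability.
(* Stage [a] looks up each [y] at the stage of its own exact rank. *)
have [|S HS] := etr (Q := fun X => Q (fun y => exists b, rk b y /\ X b y)).
  by apply: dQ; definability.
have [|T HT] := comprehension (Q := fun x => exists2 a, rk a x & opair_inc a x S).
  by definability.
exists T => x /rk_ex[a rkx]; have [aO ax amin] := rkx.
(* The exact rank of [y] is at most [b], hence below [a], so the lookup among the earlier stages
   does find it. *)
have agree b y : b ∈ a -> opair_inc b y R ->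
    ((exists c, rk c y /\ c ∈ a /\ opair_inc c y S) <-> y ∈c T).
  move=> ba bY; split=> [[c [cy [ca cS]]]|/HT[c cy cS]]; first by apply/HT; exists c.
  exists c; split=> //; split=> //.
  have [cO _ cmin] := cy; have bO := ordinal_mem aO ba.
  have [bc|[<- //|cb]] := ordinal_trichotomy bO cO; first by case: (cmin b bc).
  exact: aO.1 cb.
have -> : x ∈c T <-> opair_inc a x S.
  rewrite HT; split=> [[b rkb]|]; last by exists a.
  by rewrite (rk_uniq _ _ _ rkx rkb).
by rewrite HS //; split; apply: (Qloc a) => // b y ba bY; have := agree b y ba bY; tauto.
Qed.
End Ranks.

(** * Forcing equality of names *)

Section NameEquality.
Context {M : gb_structure} {hM : GBC M}.
Hypothesis hETR : ETR_Ord M.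
Variable P : forcing_data M.
Implicit Types (a b c p q r s x y z : M) (sigma tau rho pi : M) (R : gclass M).

Lemma below_leq k l y x : k <= l -> below k y x -> below l y x.
Proof.
elim: k l x => [|k IHk] [|l] // x kl [yx|[u ux yu]]; first by left.
by right; exists u => //; apply: IHk.
Qed.

(** Both components of a Kuratowski pair are members of its member [{a, b}], hence two steps
    down. *)
Lemma opair_below a b z : is_opair a b z -> below 2 a z /\ below 2 b z.
Proof.
move=> [u [v [Hu Hv Hz]]]; split; right; exists v => /=.
- by apply/Hz; right.
- by left; apply/Hv; left.
- by apply/Hz; right.
by left; apply/Hv; right.
Qed.

Lemma name_dom sigma rho r : is_name P sigma -> opair_in rho r sigma ->
  is_name P rho /\ fcond P r.
Proof.
move=> [t st Ht] [z Hz zs]; have [rho' [p [rt pP Hz']]] := Ht _ _ st zs.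
by have [-> ->] := opair_inj Hz Hz'; split=> //; exists t.
Qed.

Definition name_rel rho sigma : Prop := exists r, opair_in rho r sigma.

Lemma name_ranked R sigma : ranks name_rel R -> is_name P sigma -> ranked R sigma.
Proof.
(* Depth 3: the inner name is two steps below its pair, which is a member of the outer name. The
   witness of [is_name] serves as the closed set. *)
move=> HR [t st Ht]; apply: (@ranked_closed _ _ name_rel R 3 t HR _ sigma st).
move=> x y xt [r [z Hz zx]].
have [rho [p [rt _ Hz']]] := Ht _ _ xt zx; have [-> _] := opair_inj Hz Hz'.
by split=> //; right; exists z => //; have [] := opair_below Hz'.
Qed.

Lemma ranks_mono D R a b x : ranks D R -> is_ordinal a -> is_ordinal b ->
  (forall z, z ∈ a -> z ∈ b) -> opair_inc a x R -> opair_inc b x R.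
Proof.
move=> HR aO bO ab /(HR a aO) Hx; apply/(HR b bO) => y /Hx[c ca cy].
by exists c => //; apply: ab.
Qed.

(* Of two ordinals, the larger one serves for both x and y. *)
Lemma ranks_common D R (C : M -> Prop) a b x y : ranks D R ->
  is_ordinal a -> is_ordinal b -> C a -> C b ->
  opair_inc a x R -> opair_inc b y R ->
  exists c, [/\ is_ordinal c, C c, opair_inc c x R & opair_inc c y R].
Proof.
move=> HR aO bO Ca Cb ax bY.
have [ab|[eq_ab|ba]] := ordinal_trichotomy aO bO.
- exists b; split=> //; apply: (ranks_mono HR aO bO) ax => z; exact: bO.1.
- by exists a; split=> //; rewrite eq_ab.
exists a; split=> //; apply: (ranks_mono HR bO aO) bY => z; exact: aO.1.
Qed.

Section Clauses.
Variable E : M -> M -> M -> Prop.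

(* The clauses for membership and inclusion, given the relation E p sigma tau
   standing for "p forces sigma = tau". *)
Definition forces_in q rho tau : Prop :=
  densely_below P q (fun q1 => exists pi r,
    [/\ opair_in pi r tau, fle P q1 r & E q1 rho pi]).

Definition forces_sub p sigma tau : Prop :=
  forall rho r q', opair_in rho r sigma -> fle P q' p -> fle P q' r ->
    exists2 q, fle P q q' & forces_in q rho tau.
End Clauses.

(** Since the membership clause is unfolded inside inclusion, [E] is consulted only at one name from
    each domain, so that both ranks drop. *)
Lemma forces_sub_mono (E E' : M -> M -> M -> Prop) p sigma tau :
  (forall q rho pi, name_rel rho sigma -> name_rel pi tau ->
     E q rho pi -> E' q rho pi) ->
  forces_sub E p sigma tau -> forces_sub E' p sigma tau.
Proof.
move=> EE' Hsub rho r q' rs q'p q'r; have [q qq' Hq] := Hsub _ _ _ rs q'p q'r.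
exists q => // q1 q1q; have [q2 q2q1 [pi [r' [pt q2r' H]]]] := Hq _ q1q.
exists q2 => //; exists pi, r'; split=> //; apply: EE' H; first by exists r.
by exists r'.
Qed.

Definition triple_code p sigma tau x : Prop :=
  exists2 s, is_opair sigma tau s & is_opair p s x.

Definition on_triple (X : M -> Prop) p sigma tau : Prop :=
  exists2 x, triple_code p sigma tau x & X x.

Lemma triple_inj p sigma tau q rho pi x :
  triple_code p sigma tau x -> triple_code q rho pi x ->
  [/\ p = q, sigma = rho & tau = pi].
Proof.
move=> [s Hs Hx] [s' Hs' Hx']; have [-> eqs] := opair_inj Hx Hx'.
by rewrite -eqs in Hs'; have [-> ->] := opair_inj Hs Hs'.
Qed.

Lemma triple_uniq p sigma tau x y :
  triple_code p sigma tau x -> triple_code p sigma tau y -> x = y.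
Proof.
move=> [s Hs Hx] [s' Hs' Hy]; rewrite (opair_uniq Hs' Hs) in Hy.
exact: opair_uniq Hx Hy.
Qed.

Lemma triple_ex p sigma tau : exists x, triple_code p sigma tau x.
Proof.
have [s Hs] := opair_ex sigma tau; have [x Hx] := opair_ex p s.
by exists x, s.
Qed.

Lemma on_tripleE X p sigma tau x : triple_code p sigma tau x ->
  (on_triple X p sigma tau <-> X x).
Proof.
by move=> Hx; split=> [[y /(triple_uniq Hx)<-]|Xx] //; exists x.
Qed.

(* The recursion is on the larger of the ranks of sigma and tau. *)
Lemma equality_forcing : exists T : gclass M, let E := on_triple (fun x => x ∈c T) in
  forall p sigma tau, is_name P sigma -> is_name P tau ->
    (E p sigma tau <-> forces_sub E p sigma tau /\ forces_sub E p tau sigma).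
Proof.
have [|RN HRN] := ranks_ex hETR (D := name_rel); first by rewrite /name_rel; definability.
(* A common bound for both names, because the two inclusions exchange their roles. The condition
   does not count, as the clauses range over all stronger conditions. *)
have [|R HR] := comprehension2 (Q := fun a x => exists p sigma tau,
    [/\ triple_code p sigma tau x, opair_inc a sigma RN & opair_inc a tau RN]).
  by rewrite /triple_code; definability.
pose Q X x := exists p sigma tau, [/\ triple_code p sigma tau x,
  forces_sub (on_triple X) p sigma tau & forces_sub (on_triple X) p tau sigma].
have [||T HT] := ranked_recursion hETR (R := R) (Q := Q).
- move=> X dX; rewrite /Q /forces_sub /forces_in /on_triple /triple_code.
  by definability.
- move=> a x X Y aO /HR[p [sigma [tau [Hx sa ta]]]] XY.
  case=> p' [sigma' [tau' [Hx' H1 H2]]].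
  case: (triple_inj Hx Hx') H1 H2 => <- <- <- {p' sigma' tau' Hx'} H1 H2.
  have agree q rho pi : (exists2 b, b ∈ a & opair_inc b rho RN) ->
      (exists2 b, b ∈ a & opair_inc b pi RN) ->
      on_triple X q rho pi -> on_triple Y q rho pi.
    move=> [b ba brho] [c ca cpi].
    have [bO cO] := (ordinal_mem aO ba, ordinal_mem aO ca).
    (* The larger of the two bounds still lies in [a]. *)
    have [d [dO da drho dpi]] := ranks_common (C := fun d => d ∈ a) HRN bO cO ba ca brho cpi.
    case=> y Hy Xy; exists y => //; apply/(XY d) => //; apply/HR.
    by exists q, rho, pi.
  have low u v : opair_inc a v RN -> name_rel u v -> exists2 b, b ∈ a & opair_inc b u RN.
    by move=> /(HRN a aO); apply.
  exists p, sigma, tau; split=> //.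
    by apply: forces_sub_mono H1 => q rho pi r1 r2; apply: agree; [exact: low r1|exact: low r2].
  by apply: forces_sub_mono H2 => q rho pi r1 r2; apply: agree; [exact: low r1|exact: low r2].
exists T => E p sigma tau sN tN.
have [x Hx] := triple_ex p sigma tau; rewrite /E (on_tripleE _ Hx) HT.
  split=> [[p' [sigma' [tau' [Hx' H1 H2]]]]|[H1 H2]]; last by exists p, sigma, tau.
  by have [-> -> ->] := triple_inj Hx Hx'.
have [a aO sa] := name_ranked HRN sN; have [b bO tb] := name_ranked HRN tN.
have [c [cO _ sc tc]] := ranks_common (C := fun=> True) HRN aO bO I I sa tb.
by exists c => //; apply/HR; exists p, sigma, tau.
Qed.
End NameEquality.

(** * Codes of formulas *)

Section Codes.
Context {M : gb_structure} {hM : GBC M}.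
Implicit Types (a b c s t x y : M) (phi psi chi U V W I : M).

Lemma numeral_uniq n x y : is_numeral n x -> is_numeral n y -> x = y.
Proof.
elim: n x y => [|n IHn] x y /=; first exact: empty_uniq.
move=> [u Hu Hx] [v Hv Hy]; rewrite (IHn _ _ Hv Hu) in Hy.
exact: succ_uniq Hx Hy.
Qed.

Lemma numeral_ex n : exists x, is_numeral n x.
Proof.
elim: n => [|n [x Hx]]; first exact: empty_ex.
by have [y Hy] := succ_ex x; exists y, x.
Qed.

(** With [mem_irrefl], this keeps the tags of different code shapes apart. *)
Lemma numeral_lt n k x y : n < k -> is_numeral n x -> is_numeral k y -> x ∈ y.
Proof.
elim: k y => [//|k IHk] y; rewrite ltnS leq_eqVlt => /orP[/eqP->|nk] Hx [z Hz Hy].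
  by apply/Hy; right; apply: numeral_uniq Hx Hz.
by apply/Hy; left; apply: IHk.
Qed.

Lemma numeral_inj n k x : is_numeral n x -> is_numeral k x -> n = k.
Proof.
move=> Hn Hk; case: (ltngtP n k) => // H.
  by case: (@mem_irrefl _ _ x); apply: numeral_lt H Hn Hk.
by case: (@mem_irrefl _ _ x); apply: numeral_lt H Hk Hn.
Qed.

Lemma tagged_inj n k a b c : tagged n a c -> tagged k b c -> n = k /\ a = b.
Proof.
move=> [x Hx Hc] [y Hy Hc']; have [eq_x ->] := opair_inj Hc Hc'.
by rewrite -eq_x in Hy; rewrite (numeral_inj Hx Hy).
Qed.

Lemma tagged_uniq n a b c : tagged n a b -> tagged n a c -> b = c.
Proof.
move=> [x Hx Hb] [y Hy Hc]; rewrite (numeral_uniq Hy Hx) in Hc.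
exact: opair_uniq Hb Hc.
Qed.

Lemma tagged_ex n a : exists c, tagged n a c.
Proof.
by have [x Hx] := numeral_ex n; have [c Hc] := opair_ex x a; exists c, x.
Qed.

Lemma tagged2_inj n k a b a' b' c : tagged2 n a b c -> tagged2 k a' b' c ->
  a = a' /\ b = b'.
Proof.
move=> [u Hu Hc] [v Hv Hc']; have [_ eq_u] := tagged_inj Hc Hc'.
by rewrite -eq_u in Hv; apply: opair_inj Hu Hv.
Qed.

Lemma tagged2_uniq n a b c d : tagged2 n a b c -> tagged2 n a b d -> c = d.
Proof.
move=> [u Hu Hc] [v Hv Hd]; rewrite (opair_uniq Hv Hu) in Hd.
exact: tagged_uniq Hc Hd.
Qed.

Lemma tagged2_ex n a b : exists c, tagged2 n a b c.
Proof.
by have [u Hu] := opair_ex a b; have [c Hc] := tagged_ex n u; exists c, u.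
Qed.

Definition has_tag (n : nat) c : Prop := exists a, tagged n a c.

Lemma has_tag_inj n k c : has_tag n c -> has_tag k c -> n = k.
Proof. by move=> [a Ha] [b Hb]; case: (tagged_inj Ha Hb). Qed.

Lemma tagged_tag n a c : tagged n a c -> has_tag n c.
Proof. by exists a. Qed.

Lemma tagged2_tag n a b c : tagged2 n a b c -> has_tag n c.
Proof. by case=> u _ Hc; exists u. Qed.

Lemma f_gamma_tag m (i : 'I_m.+1) s phi : f_gamma i s phi -> has_tag 2 phi.
Proof. by case=> k _; apply: tagged2_tag. Qed.

Lemma f_gamma_inj m (i j : 'I_m.+1) s t phi :
  f_gamma i s phi -> f_gamma j t phi -> i = j /\ s = t.
Proof.
move=> [k Hk H] [l Hl H']; have [eq_k ->] := tagged2_inj H H'.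
by rewrite -eq_k in Hl; rewrite (val_inj (numeral_inj Hk Hl)).
Qed.

Lemma f_gamma_uniq m (i : 'I_m.+1) s phi psi :
  f_gamma i s phi -> f_gamma i s psi -> phi = psi.
Proof.
move=> [k Hk H] [l Hl H']; rewrite (numeral_uniq Hl Hk) in H'.
exact: tagged2_uniq H H'.
Qed.

Lemma f_gamma_ex m (i : 'I_m.+1) s : exists phi, f_gamma i s phi.
Proof.
have [k Hk] := numeral_ex i; have [phi Hphi] := tagged2_ex 2 k s.
by exists phi, k.
Qed.

Lemma t_name_inj s t x : t_name s x -> t_name t x -> s = t.
Proof. by move=> H H'; case: (tagged_inj H H'). Qed.

Lemma names_tagged2_inj n s t s' t' x y x' y' phi :
  t_name s x -> t_name t y -> tagged2 n x y phi ->
  t_name s' x' -> t_name t' y' -> tagged2 n x' y' phi -> s = s' /\ t = t'.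
Proof.
move=> sx ty H s'x' t'y' H'; have [eqx eqy] := tagged2_inj H H'.
rewrite -eqx in s'x'; rewrite -eqy in t'y'.
by rewrite (t_name_inj sx s'x') (t_name_inj ty t'y').
Qed.

Lemma names_tagged2_uniq n s t x y x' y' phi psi :
  t_name s x -> t_name t y -> tagged2 n x y phi ->
  t_name s x' -> t_name t y' -> tagged2 n x' y' psi -> phi = psi.
Proof.
move=> sx ty H sx' ty' H'.
rewrite (tagged_uniq sx' sx) (tagged_uniq ty' ty) in H'.
exact: tagged2_uniq H H'.
Qed.
End Codes.

Ltac code_tag H :=
  lazymatch type of H with
  | f_mem _ _ _ => constr:(tagged2_tag H)
  | f_eq _ _ _ => constr:(tagged2_tag H)
  | f_gamma _ _ _ => constr:(f_gamma_tag H)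
  | f_not _ _ => constr:(tagged_tag H)
  | f_and _ _ => constr:(tagged_tag H)
  | f_all _ _ _ => constr:(tagged2_tag H)
  end.

(** Two readings of the same code with different leading tags yield an absurd equation between
    numerals. *)
Ltac code_clash :=
  match goal with
  | H1 : _ ?phi, H2 : _ ?phi |- _ =>
    let t1 := code_tag H1 in let t2 := code_tag H2 in
    solve [exfalso; discriminate (has_tag_inj t1 t2)]
  end.

(** * Tables of formulas and ranks of formulas *)

Section Formulas.
Context {M : gb_structure} {hM : GBC M}.
Variables (P : forcing_data M) (m : nat).
Implicit Types (s t x y z : M) (phi psi chi Phi U V W I : M).

(** At a quantifier the open body counts, never its instances by names. *)
Definition subformula psi phi : Prop :=
  f_not psi phi \/ (exists2 Phi, f_and Phi phi & psi ∈ Phi) \/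
  (exists I, f_all I psi phi).

Definition formula_dep U phi W chi : Prop :=
  (W = U /\ f_not chi phi) \/
  (W = U /\ exists2 Phi, f_and Phi phi & chi ∈ Phi) \/
  (exists I, is_union2 U I W /\ f_all I chi phi).

(** The step factors into a condition on [U] and [phi] alone and closure under [formula_dep]. Such
    closure conditions survive the intersection that forms a least table and the union that joins
    several tables. *)
Lemma formula_stepE (fml : M -> M -> Prop) U phi :
  formula_step P m fml U phi <->
  formula_step P m (fun _ _ => True) U phi /\
  (forall W chi, formula_dep U phi W chi -> fml W chi).
Proof.
split.
- case=> [|[|[|[|[]]]]].
  + move=> [s [t [Hs Ht H]]]; split; first by left; exists s, t.
    by move=> W chi [[_ H']|[[_ [Phi H' _]]|[I [_ H']]]]; code_clash.
  + move=> [s [t [Hs Ht H]]]; split; first by right; left; exists s, t.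
    by move=> W chi [[_ H']|[[_ [Phi H' _]]|[I [_ H']]]]; code_clash.
  + move=> [i [s [Hs H]]]; split; first by do 2 right; left; exists i, s.
    by move=> W chi [[_ H']|[[_ [Phi H' _]]|[I [_ H']]]]; code_clash.
  + move=> [psi [Hpsi H]]; split; first by do 3 right; left; exists psi.
    move=> W chi [[-> H']|[[_ [Phi H' _]]|[I [_ H']]]]; try code_clash.
    by have [_ <-] := tagged_inj H H'.
  + move=> [Phi [HPhi H]]; split; first by do 4 right; left; exists Phi.
    move=> W chi [[-> H']|[[-> [Phi' H' HH]]|[I [_ H']]]]; try code_clash.
    by apply: HPhi; have [_ ->] := tagged_inj H H'.
  + move=> [I [psi [W [HW Hpsi H]]]]; split; first by do 5 right; exists I, psi, W.
    move=> W' chi [[-> H']|[[-> [Phi' H' HH]]|[I' [HW' H']]]]; try code_clash.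
    have [eqI <-] := tagged2_inj H H'; rewrite -eqI in HW'.
    by rewrite -(union2_uniq HW HW').
case=> [[|[|[|[|[]]]]]] .
- by move=> H _; left.
- by move=> H _; right; left.
- by move=> H _; do 2 right; left.
- move=> [psi [_ H]] HH; do 3 right; left; exists psi; split=> //.
  by apply: HH; left.
- move=> [Phi [_ H]] HH; do 4 right; left; exists Phi; split=> // psi psiPhi.
  by apply: HH; right; left; split=> //; exists Phi.
move=> [I [psi [W [HW _ H]]]] HH; do 5 right; exists I, psi, W; split=> //.
by apply: HH; do 2 right; exists I.
Qed.

Lemma formula_step_mono (fml fml' : M -> M -> Prop) U phi :
  (forall W chi, fml W chi -> fml' W chi) ->
  formula_step P m fml U phi -> formula_step P m fml' U phi.
Proof.
move=> ff' /formula_stepE[Hs Hd]; apply/formula_stepE; split=> // W chi /Hd.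
exact: ff'.
Qed.

Definition formula_table t : Prop :=
  forall V psi, opair_in V psi t ->
    formula_step P m (fun W chi => opair_in W chi t) V psi.

Definition least_table U phi t : Prop :=
  [/\ opair_in U phi t, formula_table t &
    forall t', opair_in U phi t' -> formula_table t' -> forall z, z ∈ t -> z ∈ t'].

Lemma definable_formula_table : definable1 (fun=> formula_table).
Proof. by rewrite /formula_table; definability. Qed.

(** Pairs exist and are unique, so both readings agree; the universal one passes through
    intersections. *)
Lemma opair_in_sep U phi t : opair_in U phi t <->
  forall z, is_opair U phi z -> z ∈ t.
Proof.
split=> [[z Hz zt] z' Hz'|H]; first by rewrite (opair_uniq Hz' Hz).
by have [z Hz] := opair_ex U phi; exists z => //; apply: H.
Qed.

(* Least tables make the choice of tables unnecessary when a conjunction is formed. *)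
Lemma least_table_ex U phi : is_formula P m U phi -> exists t, least_table U phi t.
Proof.
have dT := definable_formula_table.
move=> [t0 Ht0 T0]; have [|t Ht] := separation (Q := fun z => forall t',
  opair_in U phi t' -> formula_table t' -> z ∈ t') _ t0; first by definability.
exists t; split.
- apply/opair_in_sep => z Hz; apply/Ht.
  by split=> [|t' /opair_in_sep Ht' _]; [exact: (opair_in_sep U phi t0).1|exact: Ht'].
- move=> V psi [z Hz /Ht[zt0 Hmin]]; apply/formula_stepE; split.
    have: opair_in V psi t0 by exists z.
    by move/T0/formula_stepE => [].
  move=> W chi Hdep; have [w Hw] := opair_ex W chi; exists w => //.
  apply/Ht; split=> [|t' Ht' T'].
    have: opair_in V psi t0 by exists z.
    by move/T0/formula_stepE => [_ /(_ _ _ Hdep)/opair_in_sep]; apply.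
  have: opair_in V psi t' by exists z => //; apply: Hmin.
  by move/T'/formula_stepE => [_ /(_ _ _ Hdep)/opair_in_sep]; apply.
by move=> t' Ht' T' z /Ht[_]; apply.
Qed.

Lemma common_table U Phi : (forall psi, psi ∈ Phi -> is_formula P m U psi) ->
  exists2 t, formula_table t & forall psi, psi ∈ Phi -> opair_in U psi t.
Proof.
move=> HPhi; have dT := definable_formula_table.
have [||s Hs] := image_ex (Q := least_table U) _ _ Phi.
- by rewrite /least_table; definability.
- move=> psi t t' [H1 H2 H3] [H1' H2' H3']; apply: set_ext => z.
  by split; [apply: H3|apply: H3'].
have [t Ht] := gbc_union hM s; exists t.
  move=> V psi [z Hz /Ht[t' t's zt']].
  have [chi _ [_ T' _]] := (Hs t').1 t's.
  have /T' : opair_in V psi t' by exists z.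
  apply: formula_step_mono => W theta [w Hw wt']; exists w => //.
  by apply/Ht; exists t'.
move=> psi psiPhi; have [t' Ht'] := least_table_ex (HPhi _ psiPhi).
have [[z Hz zt'] _ _] := Ht'; exists z => //; apply/Ht; exists t' => //.
by apply/Hs; exists psi.
Qed.

Lemma formula_add t U phi : formula_table t ->
  formula_step P m (fun W chi => opair_in W chi t) U phi -> is_formula P m U phi.
Proof.
move=> T step; have [z Hz] := opair_ex U phi; have [s Hs] := singleton_ex z.
have [t' Ht'] := union2_ex t s.
have tt' W chi : opair_in W chi t -> opair_in W chi t'.
  by case=> w Hw wt; exists w => //; apply/Ht'; left.
exists t'; first by exists z => //; apply/Ht'; right; apply/Hs.
move=> V psi [w Hw /Ht'[wt|/Hs eq_w]].
  have /T : opair_in V psi t by exists w.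
  exact: formula_step_mono.
rewrite eq_w in Hw; have [-> ->] := opair_inj Hw Hz.
exact: formula_step_mono step.
Qed.

(** The immediate subformulas come with separate tables, which have to be gathered into one before
    the new row is added; the conjunction case rests on [common_table]. *)
Lemma formula_intro U phi :
  formula_step P m (is_formula P m) U phi -> is_formula P m U phi.
Proof.
have [o Ho] := @empty_ex M hM.
have To : formula_table o by move=> V psi [z _ /Ho].
have single W psi : is_formula P m W psi -> exists2 t, formula_table t & opair_in W psi t.
  by case=> t H1 H2; exists t.
case=> [|[|[|[|[]]]]].
- by move=> H; apply: (formula_add To); left.
- by move=> H; apply: (formula_add To); right; left.
- by move=> H; apply: (formula_add To); do 2 right; left.
- move=> [psi [/single[t T Ht] H]]; apply: (formula_add T); do 3 right; left.
  by exists psi.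
- move=> [Phi [/common_table[t T Ht] H]]; apply: (formula_add T); do 4 right; left.
  by exists Phi.
move=> [I [psi [W [HW /single[t T Ht] H]]]]; apply: (formula_add T); do 5 right.
by exists I, psi, W.
Qed.

(** The constant 4 comes from the quantifier: the body is two steps below the pair [<I, psi>], which
    is two steps below the code. *)
Lemma subformula_below psi phi : subformula psi phi -> below 4 psi phi.
Proof.
case=> [[k _ Hk]|[[Phi [k _ Hk] Hpsi]|[I [u Hu [k _ Hk]]]]].
- by apply: (@below_leq _ 2 4) => //; have [] := opair_below Hk.
- have [_ [Hf|[v vphi [Pv|[? ? []]]]]] := opair_below Hk.
    by right; exists Phi => //; left.
  by right; exists v => //; right; exists Phi => //; left.
have [_ Hpsi] := opair_below Hu.
have [_ [Hf|[v vphi [uv|[? ? []]]]]] := opair_below Hk.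
  by right; exists u => //; apply: below_leq Hpsi.
by right; exists v => //; right; exists u.
Qed.

Lemma formula_ranked R U phi : ranks subformula R -> is_formula P m U phi -> ranked R phi.
Proof.
move=> HR [t Hphi T].
(* Forgetting the sets of variables turns the table into a set of codes closed under
   [subformula]. *)
have [||s Hs] := image_ex (Q := fun z psi => exists V, is_opair V psi z) _ _ t.
- by definability.
- by move=> z psi psi' [V HV] [V' HV']; have [] := opair_inj HV HV'.
have sP psi : psi ∈ s <-> exists V, opair_in V psi t.
  rewrite Hs; split=> [[z zt [V HV]]|[V [z HV zt]]]; first by exists V, z.
  by exists z => //; exists V.
apply: (@ranked_closed _ _ subformula R 4 s HR); last by apply/sP; exists U.
move=> x y /sP[V /T/formula_stepE[_ Hdep]] yx; split; last exact: subformula_below.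
apply/sP; case: yx => [Hx|[[Phi Hx yPhi]|[I Hx]]].
- by exists V; apply: Hdep; left.
- by exists V; apply: Hdep; right; left; split=> //; exists Phi.
have [W HW] := union2_ex V I; exists W; apply: Hdep; do 2 right; by exists I.
Qed.

(** Every immediate subformula of the result arises by substitution, recorded in the same [w], from
    one of [phi]; so the bound carries over by induction on [a]. This makes quantifier clauses
    admissible in a recursion on ranks. *)
Lemma subst_rank R f phi psi a : ranks subformula R -> is_subst m f phi psi ->
  is_ordinal a -> opair_inc a phi R -> opair_inc a psi R.
Proof.
move=> HR [w Hw Tw] aO Hphi; move: a aO f phi psi Hw Hphi.
apply: (@ordinal_ind _ _ (fun a => forall f phi psi, triple_in f phi psi w ->
  opair_inc a phi R -> opair_inc a psi R)); first by definability.
move=> a aO IHa f phi psi /Tw Hstep /(HR a aO) Hphi; apply/(HR a aO) => chi.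
suff H : subformula chi psi -> exists g chi0, subformula chi0 phi /\ triple_in g chi0 chi w.
  by move=> /H[g [chi0 [/Hphi[b ba Hb] Hw]]]; exists b => //; apply: IHa Hw Hb.
case: Hstep => [|[|[|[|[]]]]].
- by move=> [s [t [s' [t' [_ _ _ H]]]]] [H'|[[Phi H' _]|[I H']]]; code_clash.
- by move=> [s [t [s' [t' [_ _ _ H]]]]] [H'|[[Phi H' _]|[I H']]]; code_clash.
- by move=> [i [s [s' [_ _ H]]]] [H'|[[Phi H' _]|[I H']]]; code_clash.
- move=> [phi' [psi' [Hsub H0 H]]] [H'|[[Phi H' _]|[I H']]]; try code_clash.
  have [_ <-] := tagged_inj H H'; exists f, phi'; split=> //; by left.
- move=> [Phi [Psi [_ HPsi H0 H]]] [H'|[[Phi' H' chiPhi]|[I H']]]; try code_clash.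
  have [_ eqPhi] := tagged_inj H H'; rewrite -eqPhi in chiPhi.
  have [phi' phi'Phi Hsub] := HPsi _ chiPhi; exists f, phi'; split=> //.
  by right; left; exists Phi.
move=> [I [g [phi' [psi' [_ Hsub H0 H]]]]] [H'|[[Phi H' _]|[J H']]]; try code_clash.
have [_ <-] := tagged2_inj H H'; exists g, phi'; split=> //.
by do 2 right; exists I.
Qed.
End Formulas.

(** * The uniform forcing relation *)

Section Sentences.
Context {M : gb_structure} {hM : GBC M}.
Variables (P : forcing_data M) (m : nat).
Implicit Types (s t x y z sigma tau : M) (phi psi chi Phi U I : M).

Lemma name_term U sigma s : is_name P sigma -> t_name sigma s -> is_term P U s.
Proof. by move=> Hn Hs; right; exists sigma. Qed.

Lemma sentence_mem sigma tau phi : is_name P sigma -> is_name P tau ->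
  names_mem sigma tau phi -> is_sentence P m phi.
Proof.
move=> sN tN [s [t [Hs Ht H]]]; have [o Ho] := empty_ex; exists o => //.
apply: formula_intro; left; exists s, t.
by split=> //; [apply: name_term Hs|apply: name_term Ht].
Qed.

Lemma sentence_eq sigma tau phi : is_name P sigma -> is_name P tau ->
  names_eq sigma tau phi -> is_sentence P m phi.
Proof.
move=> sN tN [s [t [Hs Ht H]]]; have [o Ho] := empty_ex; exists o => //.
apply: formula_intro; right; left; exists s, t.
by split=> //; [apply: name_term Hs|apply: name_term Ht].
Qed.

Lemma sentence_gamma (i : 'I_m.+1) sigma phi : is_name P sigma ->
  name_gamma sigma i phi -> is_sentence P m phi.
Proof.
move=> sN [s [Hs H]]; have [o Ho] := empty_ex; exists o => //.
apply: formula_intro; do 2 right; left; exists i, s.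
by split=> //; apply: name_term Hs.
Qed.

Lemma sentence_not phi psi : is_sentence P m psi -> f_not psi phi ->
  is_sentence P m phi.
Proof.
move=> [o Ho Hpsi] H; exists o => //; apply: formula_intro; do 3 right; left.
by exists psi.
Qed.

Lemma sentence_and Phi phi : (forall psi, psi ∈ Phi -> is_sentence P m psi) ->
  f_and Phi phi -> is_sentence P m phi.
Proof.
move=> HPhi H; have [o Ho] := empty_ex; exists o => //.
apply: formula_intro; do 4 right; left; exists Phi; split=> // psi /HPhi[u Hu].
by rewrite (empty_uniq Hu Ho).
Qed.

Lemma sentence_all I psi phi : is_formula P m I psi -> f_all I psi phi ->
  is_sentence P m phi.
Proof.
move=> Hpsi H; have [o Ho] := empty_ex; exists o => //.
apply: formula_intro; do 5 right; exists I, psi, I; split=> // z.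
by split=> [|[/Ho|]] //; right.
Qed.
End Sentences.

(** * The recursion along ranks of formulas *)

Section UniformForcing.
Context {M : gb_structure} {hM : GBC M}.
Hypothesis hETR : ETR_Ord M.
Variables (P : forcing_data M) (m : nat) (Gamma : 'I_m.+1 -> gclass M).
Variable T : gclass M.
Implicit Types (p q r s t x y z sigma tau rho : M) (phi psi chi Phi I : M).
Implicit Types (G F : M -> M -> Prop).

Let E := on_triple (fun x => x ∈c T).

Definition forces_gamma (i : 'I_m.+1) p sigma : Prop :=
  densely_below P p (fun q => exists tau r,
    [/\ opair_inc tau r (Gamma i), fle P q r & E q sigma tau]).

(** Atomic cases consult only [T]; [G] occurs only for negations, conjunctions and quantifiers.
    Instances are existential, matching the form of [forces] for [is_subst]. *)
Definition forcing_clause G p phi : Prop :=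
  (exists sigma tau, names_mem sigma tau phi /\ forces_in P E p sigma tau) \/
  (exists sigma tau, names_eq sigma tau phi /\ E p sigma tau) \/
  (exists (i : 'I_m.+1) sigma, name_gamma sigma i phi /\ forces_gamma i p sigma) \/
  (exists2 psi, f_not psi phi & ~ exists2 q, fle P q p & G q psi) \/
  (exists2 Phi, f_and Phi phi & forall psi, psi ∈ Phi -> G p psi) \/
  (exists I psi, f_all I psi phi /\ forall f, name_sequence P I f ->
     exists2 chi, is_subst m f psi chi & G p chi).

(** Unique readability: the tag of [phi] excludes the five other disjuncts. The next five lemmas
    follow the same pattern. *)
Lemma clause_mem G p sigma tau phi : names_mem sigma tau phi ->
  (forcing_clause G p phi <-> forces_in P E p sigma tau).
Proof.
move=> Hm; split; last by move=> H; left; exists sigma, tau.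
have [s [t [Hs Ht H]]] := Hm.
case=> [|[|[|[|[]]]]].
- move=> [sigma' [tau' [[s' [t' [Hs' Ht' H']]] HH]]].
  by have [-> ->] := names_tagged2_inj Hs Ht H Hs' Ht' H'.
- by move=> [sigma' [tau' [[s' [t' [_ _ H']]] _]]]; code_clash.
- by move=> [i [sigma' [[s' [_ H']] _]]]; code_clash.
- by move=> [psi H' _]; code_clash.
- by move=> [psi H' _]; code_clash.
by move=> [I [psi [H' _]]]; code_clash.
Qed.

Lemma clause_eq G p sigma tau phi : names_eq sigma tau phi ->
  (forcing_clause G p phi <-> E p sigma tau).
Proof.
move=> Hm; split; last by move=> H; right; left; exists sigma, tau.
have [s [t [Hs Ht H]]] := Hm.
case=> [|[|[|[|[]]]]].
- by move=> [sigma' [tau' [[s' [t' [_ _ H']]] _]]]; code_clash.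
- move=> [sigma' [tau' [[s' [t' [Hs' Ht' H']]] HH]]].
  by have [-> ->] := names_tagged2_inj Hs Ht H Hs' Ht' H'.
- by move=> [i [sigma' [[s' [_ H']] _]]]; code_clash.
- by move=> [psi H' _]; code_clash.
- by move=> [psi H' _]; code_clash.
by move=> [I [psi [H' _]]]; code_clash.
Qed.

Lemma clause_gamma G p (i : 'I_m.+1) sigma phi : name_gamma sigma i phi ->
  (forcing_clause G p phi <-> forces_gamma i p sigma).
Proof.
move=> Hm; split; last by move=> H; do 2 right; left; exists i, sigma.
have [s [Hs H]] := Hm.
case=> [|[|[|[|[]]]]].
- by move=> [sigma' [tau' [[s' [t' [_ _ H']]] _]]]; code_clash.
- by move=> [sigma' [tau' [[s' [t' [_ _ H']]] _]]]; code_clash.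
- move=> [j [sigma' [[s' [Hs' H']] HH]]]; have [-> eqs] := f_gamma_inj H H'.
  by rewrite -eqs in Hs'; rewrite (t_name_inj Hs Hs').
- by move=> [psi H' _]; code_clash.
- by move=> [psi H' _]; code_clash.
by move=> [I [psi [H' _]]]; code_clash.
Qed.

Lemma clause_not G p psi phi : f_not psi phi ->
  (forcing_clause G p phi <-> ~ exists2 q, fle P q p & G q psi).
Proof.
move=> H; split; last by move=> HH; do 3 right; left; exists psi.
case=> [|[|[|[|[]]]]].
- by move=> [sigma' [tau' [[s' [t' [_ _ H']]] _]]]; code_clash.
- by move=> [sigma' [tau' [[s' [t' [_ _ H']]] _]]]; code_clash.
- by move=> [i [sigma' [[s' [_ H']] _]]]; code_clash.
- by move=> [psi' H' HH]; have [_ ->] := tagged_inj H H'.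
- by move=> [psi' H' _]; code_clash.
by move=> [I [psi' [H' _]]]; code_clash.
Qed.

Lemma clause_and G p Phi phi : f_and Phi phi ->
  (forcing_clause G p phi <-> forall psi, psi ∈ Phi -> G p psi).
Proof.
move=> H; split; last by move=> HH; do 4 right; left; exists Phi.
case=> [|[|[|[|[]]]]].
- by move=> [sigma' [tau' [[s' [t' [_ _ H']]] _]]]; code_clash.
- by move=> [sigma' [tau' [[s' [t' [_ _ H']]] _]]]; code_clash.
- by move=> [i [sigma' [[s' [_ H']] _]]]; code_clash.
- by move=> [psi' H' _]; code_clash.
- by move=> [psi' H' HH]; have [_ ->] := tagged_inj H H'.
by move=> [I [psi' [H' _]]]; code_clash.
Qed.

Lemma clause_all G p I psi phi : f_all I psi phi ->
  (forcing_clause G p phi <-> forall f, name_sequence P I f ->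
     exists2 chi, is_subst m f psi chi & G p chi).
Proof.
move=> H; split; last by move=> HH; do 5 right; exists I, psi.
case=> [|[|[|[|[]]]]].
- by move=> [sigma' [tau' [[s' [t' [_ _ H']]] _]]]; code_clash.
- by move=> [sigma' [tau' [[s' [t' [_ _ H']]] _]]]; code_clash.
- by move=> [i [sigma' [[s' [_ H']] _]]]; code_clash.
- by move=> [psi' H' _]; code_clash.
- by move=> [psi' H' _]; code_clash.
by move=> [J [psi' [H' HH]]]; have [-> ->] := tagged2_inj H H'.
Qed.

(** For a quantifier, one bound [b] of the body serves the whole proper class of instances by
    [subst_rank]. *)
Lemma forcing_clause_local R a G F p phi : ranks (@subformula M) R ->
  is_ordinal a -> opair_inc a phi R ->
  (forall q psi b, b ∈ a -> opair_inc b psi R -> (G q psi <-> F q psi)) ->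
  forcing_clause G p phi -> forcing_clause F p phi.
Proof.
move=> HR aO /(HR a aO) Hphi GF.
case=> [|[|[|[|[]]]]].
- by left.
- by right; left.
- by do 2 right; left.
- move=> [psi H nG]; do 3 right; left; exists psi => //.
  have [|b ba Hb] := Hphi psi; first by left.
  by move=> [q qp /(GF q psi b ba Hb) Gq]; apply: nG; exists q.
- move=> [Phi H HG]; do 4 right; left; exists Phi => // psi Hpsi.
  have [|b ba Hb] := Hphi psi; first by right; left; exists Phi.
  by apply/(GF p psi b ba Hb); apply: HG.
move=> [I [psi [H HG]]]; do 5 right; exists I, psi; split=> // f /HG[chi Hchi Gchi].
have [|b ba Hb] := Hphi psi; first by do 2 right; exists I.
exists chi => //; apply/(GF p chi b ba) => //.
by apply: subst_rank Hchi _ Hb => //; apply: ordinal_mem ba.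
Qed.

Lemma forcing_class_ex : exists F : gclass M,
  (forall z, z ∈c F -> exists p phi,
    [/\ fcond P p, is_sentence P m phi & is_opair p phi z]) /\
  (forall p phi, fcond P p -> is_sentence P m phi -> (opair_inc p phi F <->
    forcing_clause (fun q psi => opair_inc q psi F) p phi)).
Proof.
have [|RF HRF] := ranks_ex hETR (D := @subformula M).
  by rewrite /subformula; definability.
(* Only [phi] is ranked, since the negation clause ranges over all [q] below [p]. *)
have [|R HR] := comprehension2 (Q := fun a x => exists p phi,
    is_opair p phi x /\ opair_inc a phi RF); first by definability.
(* The filter to conditions and sentences is built into the recursion, so that [F], cut out of [S]
   by the same filter, satisfies the same clauses. *)
pose G (X : M -> Prop) p phi :=
  [/\ fcond P p, is_sentence P m phi & exists2 z, is_opair p phi z & X z].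
pose Q X x := exists p phi, is_opair p phi x /\ forcing_clause (G X) p phi.
have [||S HS] := ranked_recursion hETR (R := R) (Q := Q).
- move=> X dX; rewrite /Q /forcing_clause /forces_gamma /forces_in /E /on_triple.
  by rewrite /triple_code /G; definability.
- move=> a x X Y aO /HR[p [phi [Hx Hphi]]] XY [p' [phi' [Hx' H]]].
  case: (opair_inj Hx Hx') H => <- <- H {p' phi' Hx'}.
  exists p, phi; split=> //; apply: forcing_clause_local HRF aO Hphi _ H.
  move=> q psi b ba Hb; have XYz z : is_opair q psi z -> (X z <-> Y z).
    by move=> Hz; apply: (XY b) => //; apply/HR; exists q, psi.
  by split=> -[qP psiS [z Hz Xz]]; split=> //; exists z => //; apply/XYz.
have [|F HF] := comprehension (Q := fun z => exists p phi,
  is_opair p phi z /\ G (fun x => x ∈c S) p phi); first by rewrite /G; definability.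
have FG p phi : opair_inc p phi F <-> G (fun x => x ∈c S) p phi.
  split=> [[z Hz /HF[p' [phi' [/(opair_inj Hz)[<- <-]]]]]|H] //.
  by have [_ _ [z Hz _]] := H; exists z => //; apply/HF; exists p, phi.
exists F; split=> [z /HF[p [phi [Hz [pP phiS _]]]]|p phi pP phiS].
  by exists p, phi.
rewrite FG; have [x Hx] := opair_ex p phi.
have [a aO Ha] : ranked RF phi by have [U _ HU] := phiS; apply: formula_ranked HU.
have Sx : x ∈c S <-> Q (fun y => y ∈c S) x.
  by apply: HS; exists a => //; apply/HR; exists p, phi.
have -> : G (fun x => x ∈c S) p phi <-> x ∈c S.
  split=> [[_ _ [z Hz zS]]|xS]; first by rewrite (opair_uniq Hx Hz).
  by split=> //; exists x.
rewrite Sx; split=> [[p' [phi' [Hx' H]]]|H].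
  case: (opair_inj Hx Hx') H => <- <- H.
  (* Locality doubles as extensionality: it replaces the filtered [S] by the pointwise equivalent
     [F]. *)
  by apply: forcing_clause_local HRF aO Ha _ H => *; rewrite FG.
exists p, phi; split=> //.
by apply: forcing_clause_local HRF aO Ha _ H => *; rewrite FG.
Qed.
End UniformForcing.

(** * Verification of the clauses *)

Lemma forcesE (M : gb_structure) (F : gclass M) (p phi : M) (K : M -> Prop) :
  K phi -> (forall psi, K psi -> psi = phi) -> (forces F p K <-> opair_inc p phi F).
Proof.
by move=> Kphi Kuniq; split=> [[psi /Kuniq->]|H] //; exists phi.
Qed.

Theorem theorem13 (M : gb_structure) (hM : GBC M) (hETR : ETR_Ord M)
    (P : forcing_data M) (hP : class_forcing P)
    (m : nat) (Gamma : 'I_m.+1 -> gclass M)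
    (hGamma : forall i : 'I_m.+1, is_class_name P (Gamma i)) :
  exists F : gclass M, uniform_forcing_relation P Gamma F.
Proof.
have [T HE] := equality_forcing hETR P; set E := on_triple _ in HE.
have [F [Fdom HF]] := forcing_class_ex hETR P Gamma T.
have le_cond q p : fle P q p -> fcond P q.
  by move=> [z Hz /(cf_order hP)[q' [p' [qP _ /(opair_inj Hz)[-> _]]]]].
have Feq p sigma tau : fcond P p -> is_name P sigma -> is_name P tau ->
    (forces F p (names_eq sigma tau) <-> E p sigma tau).
  move=> pP sN tN.
  have [s Hs] := tagged_ex 1 sigma; have [t Ht] := tagged_ex 1 tau.
  have [phi Hphi] := tagged2_ex 1 s t.
  have K : names_eq sigma tau phi by exists s, t.
  rewrite (forcesE _ _ K); first by rewrite HF ?(clause_eq _ _ _ _ _ K) //; exact: (sentence_eq m sN tN K).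
  by move=> psi [s' [t' [Hs' Ht' H']]]; apply: names_tagged2_uniq Hs' Ht' H' Hs Ht Hphi.
have Fmem p sigma tau : fcond P p -> is_name P sigma -> is_name P tau ->
    (forces F p (names_mem sigma tau) <-> forces_in P E p sigma tau).
  move=> pP sN tN.
  have [s Hs] := tagged_ex 1 sigma; have [t Ht] := tagged_ex 1 tau.
  have [phi Hphi] := tagged2_ex 0 s t.
  have K : names_mem sigma tau phi by exists s, t.
  rewrite (forcesE _ _ K); first by rewrite HF ?(clause_mem _ _ _ _ _ K) //; exact: (sentence_mem m sN tN K).
  by move=> psi [s' [t' [Hs' Ht' H']]]; apply: names_tagged2_uniq Hs' Ht' H' Hs Ht Hphi.
(* The facts about [F] hold at conditions only, and [le_cond] ensures that density involves no other
   sets. *)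
have dense_ext p (D D' : M -> Prop) : (forall q, fcond P q -> (D q <-> D' q)) ->
    (densely_below P p D <-> densely_below P p D').
  move=> DD'; split=> H q' /H[q qq' Dq]; exists q => //.
    exact/(DD' q (le_cond _ _ qq')).
  exact/(DD' q (le_cond _ _ qq')).
have Fsub p sigma tau : is_name P sigma -> is_name P tau ->
    (forces_subset P F p sigma tau <-> forces_sub P E p sigma tau).
  move=> sN tN; split=> H rho r q' rs q'p q'r;
    have [q qq' Hq] := H _ _ _ rs q'p q'r; exists q => //;
    have [rN _] := name_dom sN rs; exact/(Fmem q rho tau (le_cond _ _ qq')).
exists F; split=> //.
- move=> p sigma tau pP sN tN; rewrite Fmem //; apply: dense_ext => q qP.
  split=> -[rho [r [rt qr Hq]]]; exists rho, r; split=> //;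
    have [rN _] := name_dom tN rt; exact/Feq.
- by move=> p sigma tau pP sN tN; rewrite Feq // HE // !Fsub.
- move=> p sigma i pP sN.
  have [s Hs] := tagged_ex 1 sigma; have [phi Hphi] := f_gamma_ex i s.
  have K : name_gamma sigma i phi by exists s.
  rewrite (forcesE _ _ K); last first.
    move=> psi [s' [Hs' H']]; rewrite (tagged_uniq Hs' Hs) in H'.
    exact: f_gamma_uniq H' Hphi.
  rewrite HF ?(clause_gamma _ _ _ _ _ K) //; last exact: (sentence_gamma sN K).
  apply: dense_ext => q qP.
  (* Members of a class name have names as first components, as [Feq] requires. *)
  split=> -[tau [r [tG qr Hq]]]; exists tau, r; split=> //;
    have tN : is_name P tau by
      [have [z Hz /hGamma[tau' [r' [tN _ /(opair_inj Hz)[-> _]]]]] := tG];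
    exact/Feq.
- move=> p Phi pP HPhi; have [phi K] := tagged_ex 4 Phi.
  rewrite (forcesE _ _ K); last by move=> psi H; apply: tagged_uniq H K.
  by rewrite HF ?(clause_and _ _ _ _ _ K) //; exact: (sentence_and HPhi K).
- move=> p psi pP Hpsi; have [phi K] := tagged_ex 3 psi.
  rewrite (forcesE _ _ K); last by move=> chi H; apply: tagged_uniq H K.
  by rewrite HF ?(clause_not _ _ _ _ _ K) //; exact: (sentence_not Hpsi K).
move=> p I psi pP Hpsi; have [phi K] := tagged2_ex 5 I psi.
rewrite (forcesE _ _ K); last by move=> chi H; apply: tagged2_uniq H K.
by rewrite HF ?(clause_all _ _ _ _ _ K) //; exact: (sentence_all Hpsi K).
Qed.
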